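(* Let $(R,\mathfrak{m})$ be a Cohen-Macaulay local ring of dimension $d\ge 1$ with infinite residue field and let $I \subset R$ be an $\mathfrak{m}$-primary ideal. Suppose that $I \subset \mathfrak{m}^k$ for some integer $k \ge 2$. Then $$e_1(I) \le \binom{e_0(I)-k}{2}.$$
   Context: Rings are commutative and Noetherian. $\lambda(\cdot)$ denotes length. For an $\mathfrak m$-primary ideal $I$ in a Cohen-Macaulay local ring $(R,\mathfrak m)$ of dimension $d\ge 1$, the Hilbert coefficients $e_0(I),\dots,e_d(I)$ are the integers such that $\lambda(R/I^{n+1}) = e_0(I)\binom{n+d}{d}-e_1(I)\binom{n+d-1}{d-1}+\cdots+(-1)^d e_d(I)$ for all large $n$. Here $\binom{a}{2}=a(a-1)/2$. *)

(* Defs.v *)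
From mathcomp Require Import all_boot all_order all_algebra.
From mathcomp Require Import boolp classical_sets cardinality.

Set Implicit Arguments.
Unset Strict Implicit.
Unset Printing Implicit Defensive.

Import GRing.Theory Num.Theory.
Local Open Scope ring_scope.
Local Open Scope classical_set_scope.

Definition is_max (A : set nat) (n : nat) : Prop :=
  A n /\ forall m, A m -> (m <= n)%N.

(* A chain c 0 < ... < c n has length n, although it has n.+1 members. *)
Definition chain_lengths (T : Type) (P : set (set T)) : set nat :=
  [set n | exists c : nat -> set T,
     (forall i, (i <= n)%N -> P (c i)) /\
     (forall i, (i < n)%N -> c i `<` c i.+1)].

Section CommutativeAlgebra.
Variable R : comNzRingType.
Implicit Types (I J m p q : set R) (s : seq R) (d n l : nat).

(* The unit ideal is allowed. *)
Definition ideal : set (set R) :=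
  [set I | I 0 /\ forall a x y, I x -> I y -> I (a * x + y)].

Definition ideal_gen (A : set R) : set R := smallest ideal A.

Definition ideal_mul I J : set R := ideal_gen [set x * y | x in I & y in J].

Definition ideal_exp I n : set R := iter n (ideal_mul I) setT.

Definition noetherian : Prop :=
  forall I, ideal I -> exists s, I = ideal_gen [set` s].

Definition prime_ideal : set (set R) :=
  [set p | [/\ ideal p, ~ p 1 & forall x y, p (x * y) -> p x \/ p y]].

Definition maximal_ideal : set (set R) :=
  [set m | [/\ ideal m, ~ m 1 &
     forall J, ideal J -> ~ J 1 -> m `<=` J -> J = m]].

Definition local_ring m : Prop :=
  maximal_ideal m /\ forall J, maximal_ideal J -> J = m.

(* R / m, as the set of cosets x + m. *)
Definition residue_field m : set (set R) :=
  range (fun x => [set y | m (y - x)]).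

Definition radical I : set R := [set x | exists n, I (x ^+ n)].

Definition primary_ideal : set (set R) :=
  [set q | [/\ ideal q, ~ q 1 &
     forall x y, q (x * y) -> q x \/ exists n, q (y ^+ n)]].

Definition primary_for m I : Prop := primary_ideal I /\ radical I = m.

Definition krull_dim d : Prop := is_max (chain_lengths prime_ideal) d.

Definition regular_seq s : Prop :=
  (forall i, (i < size s)%N -> forall y,
     ideal_gen [set` take i s] (s`_i * y) -> ideal_gen [set` take i s] y) /\
  ~ ideal_gen [set` s] 1.

Definition depth m n : Prop :=
  is_max [set n | exists s, [/\ size s = n, [set` s] `<=` m & regular_seq s]] n.

Definition cohen_macaulay m : Prop := exists2 d, krull_dim d & depth m d.

(* The length of the R-module R / J is l (in particular it is finite); the
   submodules of R / J are the K / J with K an ideal containing J. *)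
Definition quot_length J l : Prop :=
  is_max (chain_lengths [set K | ideal K /\ J `<=` K]) l.

(* e i is e_i(I) for i <= d; the values of e beyond d are irrelevant. *)
Definition hilbert_coefficients d I (e : nat -> int) : Prop :=
  exists N, forall n, (N <= n)%N ->
    exists2 l, quot_length (ideal_exp I n.+1) l &
      l%:Z = \sum_(i < d.+1) (-1) ^+ i * e i * 'C(n + d - i, d - i)%:Z.

End CommutativeAlgebra.

Arguments noetherian R : clear implicits.
Arguments krull_dim R d : clear implicits.

(* Exact division: a * (a - 1) is even. *)
Definition binom2 (a : int) : int := (a * (a - 1) %/ 2)%Z.

(* Main.v *)
(** Modulo a general element x of I that is superficial and a nonzerodivisor the
    dimension drops by one while e_0 and e_1 are unchanged, so only dimension one
    matters.  There, put H(n) = length(I^n / I^(n+1)).  Let r + 1 be the least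
    n >= 1 for which I^n has at most n generators.  By Eakin and Sathaye
    I^(r+1) = y I^r for some y in I, hence H(n) = e_0 for n >= r and
    e_1 = sum_(n < r) (e_0 - H(n)).  For n < r, I^n has at least n + 1 generators;
    each m^j I^n has at least one, and m I^n has at least two unless m is
    principal, in which case I is principal and e_1 = 0.  Since
    I^(n+1) is contained in m^k I^n, this gives
    H(n) >= (n + 1) + 2 + (k - 2) = n + k + 1, and with E = e_0 - k
    2 e_1 <= E (E - 1) - (E - r) (E - r - 1) <= E (E - 1).

    Rings R / J are not formed: everything is said about ideals of R modulo J.
    A general element is sum_i t^i c_i, with c_i generating I and t ranging over
    a sequence of elements that are distinct modulo m. *)

Require Import Defs.
From mathcomp Require Import all_boot all_order all_algebra.
From mathcomp Require Import boolp classical_sets cardinality functions.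
From mathcomp Require Import ring zify.

Set Implicit Arguments.
Unset Strict Implicit.
Unset Printing Implicit Defensive.

Import Order.TTheory GRing.Theory Num.Theory.
Local Open Scope ring_scope.
Local Open Scope classical_set_scope.

(** * Ideals *)

(** The element x must be a nonzerodivisor modulo J, superficial for I, and compatible with the
    regular sequence supplied by the Cohen-Macaulay property. In place of prime avoidance there is
    one statement about a Noetherian ring S and an ideal H: if no element outside H is carried into
    H by all the c_i, then all but finitely many elements \sum_i t^i c_i are nonzerodivisors modulo
    H. Differences of the t are units, so by Vandermonde as many of these elements as there are c_i
    can replace the c_i. With S = R this gives regularity; with S the Rees algebra and H the lift of
    the torsion of the associated graded ring it gives superficiality, because that torsion vanishes
    in high degrees. In the theorem of Eakin and Sathaye, a general element means one whose
    multiplication map has maximal rank; a small rank is a determinantal condition, so the infinite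
    residue field enters a second time. The second generator of m I^n comes from invertibility: over
    a local ring, the factors of a principal ideal generated by a nonzerodivisor are themselves
    principal. *)

Lemma bounded_max (P : nat -> Prop) (N : nat) :
  (exists n, P n) -> (forall n, P n -> (n <= N)%N) -> exists n, is_max P n.
Proof.
move=> exP PN.
have ex : exists n, `[< P n >] by case: exP => n Pn; exists n; apply/asboolP.
have ub n : `[< P n >] -> (n <= N)%N by move/asboolP; exact: PN.
case: (ex_maxnP ex ub) => n /asboolP Pn nmax; exists n; split=> // j Pj.
by apply: nmax; apply/asboolP.
Qed.

Lemma has_min (P : nat -> Prop) :
  (exists n, P n) -> exists n, P n /\ forall j, (j < n)%N -> ~ P j.
Proof.
move=> exP.
have ex : exists n, `[< P n >] by case: exP => n Pn; exists n; apply/asboolP.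
case: (ex_minnP ex) => n /asboolP Pn nmin; exists n; split=> // j jn Pj.
by have := nmin j (introT (asboolP _) Pj); rewrite leqNgt jn.
Qed.

Section Ideals.
Variable R : comNzRingType.
Implicit Types (A B C I J K L : set R) (x y z a b c u v w : R).

Lemma ideal0 I : ideal I -> I 0. Proof. by case. Qed.

Lemma idealD I x y : ideal I -> I x -> I y -> I (x + y).
Proof. by move=> [_ h] hx hy; have := h 1 x y hx hy; rewrite mul1r. Qed.

Lemma idealZl I a x : ideal I -> I x -> I (a * x).
Proof. by move=> [h0 h] hx; have := h a x 0 hx h0; rewrite addr0. Qed.

Lemma idealZr I a x : ideal I -> I x -> I (x * a).
Proof. by rewrite mulrC; exact: idealZl. Qed.

Lemma idealN I x : ideal I -> I x -> I (- x).
Proof. by move=> iI hx; rewrite -mulN1r; exact: idealZl. Qed.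

Lemma idealB I x y : ideal I -> I x -> I y -> I (x - y).
Proof. by move=> iI hx hy; apply: idealD => //; exact: idealN. Qed.

Lemma ideal_addr I x y : ideal I -> I y -> I (x + y) -> I x.
Proof. by move=> iI hy h; have := idealB iI h hy; rewrite addrK. Qed.

Lemma ideal_sum I (T : Type) (r : seq T) (P : pred T) (F : T -> R) :
  ideal I -> (forall i, P i -> I (F i)) -> I (\sum_(i <- r | P i) F i).
Proof.
move=> iI h; apply: (big_ind I) => //; first exact: ideal0.
by move=> x y; exact: idealD.
Qed.

Lemma idealT : ideal (setT : set R). Proof. by []. Qed.

Lemma ideal1_setT I : ideal I -> I 1 -> I = setT.
Proof.
by move=> iI h1; apply/seteqP; split=> // x _; rewrite -(mulr1 x); exact: idealZl.
Qed.

Lemma ideal_gen_ideal A : ideal (ideal_gen A).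
Proof.
split=> [I [[h0 _] _] //|a x y hx hy I [iI AI]].
by apply: idealD (iI) _ _; [apply: idealZl => //; exact: hx|exact: hy].
Qed.

Lemma sub_ideal_gen A : A `<=` ideal_gen A.
Proof. exact: sub_smallest. Qed.

Lemma ideal_gen_min A I : ideal I -> A `<=` I -> ideal_gen A `<=` I.
Proof. by move=> iI AI; exact: smallest_sub. Qed.

Lemma ideal_mul_ideal I J : ideal (ideal_mul I J).
Proof. exact: ideal_gen_ideal. Qed.

Lemma mem_ideal_mul I J x y : I x -> J y -> ideal_mul I J (x * y).
Proof. by move=> hx hy; apply: sub_ideal_gen; exists x => //; exists y. Qed.

Lemma ideal_mul_min I J L : ideal L ->
  (forall x y, I x -> J y -> L (x * y)) -> ideal_mul I J `<=` L.
Proof.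
by move=> iL h; apply: ideal_gen_min => // _ [x hx [y hy <-]]; exact: h.
Qed.

Lemma ideal_exp_ideal I n : ideal (ideal_exp I n).
Proof. by case: n => [|n]; [exact: idealT|exact: ideal_mul_ideal]. Qed.

Lemma ideal_mulSr I J J' : J `<=` J' -> ideal_mul I J `<=` ideal_mul I J'.
Proof.
move=> JJ; apply: ideal_mul_min; first exact: ideal_mul_ideal.
by move=> x y hx /JJ; exact: mem_ideal_mul.
Qed.

Lemma ideal_mulSl I I' J : I `<=` I' -> ideal_mul I J `<=` ideal_mul I' J.
Proof.
move=> II; apply: ideal_mul_min; first exact: ideal_mul_ideal.
by move=> x y /II; exact: mem_ideal_mul.
Qed.

Lemma ideal_mul_subr I J : ideal J -> ideal_mul I J `<=` J.
Proof. by move=> iJ; apply: ideal_mul_min => // x y _; exact: idealZl. Qed.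

(** Besides its role for superficial elements, the colon ideal serves product ideals: a condition
    [K (x * u)] checked on generators u extends to the ideal they generate. *)
Definition colon K x : set R := [set u | K (x * u)].

Lemma colon_ideal K x : ideal K -> ideal (colon K x).
Proof.
move=> iK; split=> [|a u v]; rewrite /colon /= ?mulr0; first exact: ideal0.
move=> hu hv; rewrite mulrDr mulrCA; apply: idealD => //; exact: idealZl.
Qed.

Lemma mem_ideal_expD I i j x y :
  ideal_exp I i x -> ideal_exp I j y -> ideal_exp I (i + j) (x * y).
Proof.
elim: i x => [|i IH] x hx hy.
  exact: idealZl (ideal_exp_ideal _ _) hy.
rewrite mulrC.
apply: (ideal_mul_min (colon_ideal y (ideal_exp_ideal I (i.+1 + j))) _ hx).
move=> a b ha hb; rewrite /colon /= mulrCA.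
by apply: mem_ideal_mul => //; rewrite mulrC; exact: IH.
Qed.

Lemma mem_ideal_expX I x n : I x -> ideal_exp I n (x ^+ n).
Proof. by move=> hx; elim: n => // n IH; rewrite exprS; exact: mem_ideal_mul. Qed.

Lemma mem_ideal_exp1 I x : I x -> ideal_exp I 1 x.
Proof. by move/(mem_ideal_expX 1). Qed.

Lemma ideal_exp1 I : ideal I -> ideal_exp I 1 = I.
Proof.
move=> iI; apply/seteqP; split=> [|x]; last exact: mem_ideal_exp1.
by apply: ideal_mul_min => // x y hx _; exact: idealZr.
Qed.

(** Together with [mem_ideal_expD] this is I^(i+j) = I^i I^j. *)
Lemma ideal_exp_min I i j L : ideal L ->
  (forall x y, ideal_exp I i x -> ideal_exp I j y -> L (x * y)) ->
  ideal_exp I (i + j) `<=` L.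
Proof.
elim: i L => [|i IH] L iL h; first by move=> y hy; rewrite -(mul1r y); exact: h.
apply: ideal_mul_min => // x w hx hw.
apply: (IH (colon L x)) hw; first exact: colon_ideal.
move=> y z hy hz; rewrite /colon /= mulrA; apply: h => //; exact: mem_ideal_mul.
Qed.

Lemma ideal_expS I n : ideal_exp I n.+1 `<=` ideal_exp I n.
Proof. by apply: ideal_mul_subr; exact: ideal_exp_ideal. Qed.

Lemma ideal_exp_le I i j : (i <= j)%N -> ideal_exp I j `<=` ideal_exp I i.
Proof.
move=> /subnKC <-; elim: (j - i)%N => [|p IH]; first by rewrite addn0.
by rewrite addnS; apply: subset_trans IH; exact: ideal_expS.
Qed.

Definition ideal_add I J : set R := [set z | exists2 x, I x & exists2 y, J y & z = x + y].

Lemma ideal_add_ideal I J : ideal I -> ideal J -> ideal (ideal_add I J).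
Proof.
move=> iI iJ; split=> [|a _ _ [x hx [y hy ->]] [x' hx' [y' hy' ->]]].
  by exists 0; [exact: ideal0|exists 0; [exact: ideal0|rewrite addr0]].
exists (a * x + x'); first by apply: idealD => //; exact: idealZl.
exists (a * y + y'); first by apply: idealD => //; exact: idealZl.
by ring.
Qed.

Lemma ideal_add_subl I J : ideal J -> I `<=` ideal_add I J.
Proof. by move=> iJ x hx; exists x => //; exists 0; [exact: ideal0|rewrite addr0]. Qed.

Lemma ideal_add_subr I J : ideal I -> J `<=` ideal_add I J.
Proof. by move=> iJ x hx; exists 0; [exact: ideal0|exists x; rewrite ?add0r]. Qed.

Lemma ideal_add_min I J L : ideal L -> I `<=` L -> J `<=` L -> ideal_add I J `<=` L.
Proof. by move=> iL IL JL _ [x /IL hx [y /JL hy ->]]; exact: idealD. Qed.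

Lemma ideal_addS I I' J J' : I `<=` I' -> J `<=` J' -> ideal_add I J `<=` ideal_add I' J'.
Proof. by move=> II JJ _ [x /II hx [y /JJ hy ->]]; exists x => //; exists y. Qed.

Lemma ideal_add_idl I J : ideal I -> I `<=` J -> ideal J -> ideal_add I J = J.
Proof.
move=> iI IJ iJ; apply/seteqP; split; last exact: ideal_add_subr.
exact: ideal_add_min.
Qed.

Lemma ideal_addC I J : ideal_add I J = ideal_add J I.
Proof.
by apply/seteqP; split=> _ [x hx [y hy ->]]; exists y => //; exists x; rewrite // addrC.
Qed.

Lemma ideal_addA I J K : ideal_add I (ideal_add J K) = ideal_add (ideal_add I J) K.
Proof.
apply/seteqP; split.
  move=> _ [x hx [_ [y hy [z hz ->]] ->]]; exists (x + y); last by exists z; rewrite ?addrA.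
  by exists x => //; exists y.
move=> _ [_ [x hx [y hy ->]] [z hz ->]]; exists x => //; exists (y + z); rewrite ?addrA //.
by exists y => //; exists z.
Qed.

Definition scale x A : set R := [set x * a | a in A].

Lemma scale_ideal x A : ideal A -> ideal (scale x A).
Proof.
move=> iA; split=> [|c _ _ [a ha <-] [b hb <-]].
  by exists 0; [exact: ideal0|rewrite mulr0].
by exists (c * a + b); [apply: idealD => //; exact: idealZl|ring].
Qed.

Lemma mem_scale x A a : A a -> scale x A (x * a). Proof. by exists a. Qed.

Lemma scale_min x A L : (forall a, A a -> L (x * a)) -> scale x A `<=` L.
Proof. by move=> h _ [a ha <-]; exact: h. Qed.

Definition addx J x : set R := ideal_add J (scale x setT).

Lemma addx_ideal J x : ideal J -> ideal (addx J x).
Proof. by move=> iJ; apply: ideal_add_ideal => //; exact: scale_ideal. Qed.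

Lemma sub_addx J x : J `<=` addx J x.
Proof. by apply: ideal_add_subl; exact: scale_ideal. Qed.

Lemma mem_addx J x : ideal J -> addx J x x.
Proof.
by move=> iJ; apply: (ideal_add_subr iJ); exists 1; rewrite ?mulr1.
Qed.

Lemma addxP J x z : addx J x z <-> exists2 j, J j & exists r, z = j + x * r.
Proof.
split=> [[j hj [_ [r _ <-] ->]]|[j hj [r ->]]]; exists j => //; first by exists r.
by exists (x * r) => //; exists r.
Qed.

Lemma addx_min J x L : ideal L -> J `<=` L -> L x -> addx J x `<=` L.
Proof.
move=> iL JL Lx; apply: ideal_add_min => //; apply: scale_min => a _; exact: idealZr.
Qed.

Lemma addxC J x y : addx (addx J x) y = addx (addx J y) x.
Proof. by rewrite /addx -!ideal_addA (ideal_addC (scale x _)). Qed.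

(** Nonzerodivisor on R / J, where J + xR may be the unit ideal. *)
Definition nzd J x := forall u, J (x * u) -> J u.

Lemma nzdX J x n : nzd J x -> nzd J (x ^+ n).
Proof.
move=> h; elim: n => [|n IH] u; first by rewrite expr0 mul1r.
by rewrite exprS -mulrA => /h /IH.
Qed.

(** If x u = j + y r, then y r vanishes modulo (J, x), hence r = j' + x r', and cancelling x puts u
    - y r' in J. This exchange moves a chosen element in front of a given regular sequence. *)
Lemma nzd_swap J x y : ideal J -> nzd J x -> nzd (addx J x) y -> nzd (addx J y) x.
Proof.
move=> iJ hx hy u /addxP[j hj [r e]].
have /hy /addxP[j' hj' [r' er]] : addx J x (y * r).
  apply/addxP; exists (- j); first exact: idealN.
  by exists u; rewrite e addrA addNr add0r.
have /hx h : J (x * (u - y * r')).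
  have -> : x * (u - y * r') = j + y * j' by rewrite mulrBr e er; ring.
  by apply: idealD => //; exact: idealZl.
by apply/addxP; exists (u - y * r') => //; exists r'; rewrite subrK.
Qed.

(** * Chain conditions, units and Nakayama's lemma *)

Section Noetherian.
Hypothesis R_noeth : noetherian R.

Lemma ideal_acc (N : nat -> set R) : (forall i, ideal (N i)) ->
  (forall i, N i `<=` N i.+1) -> exists n, forall i, N i `<=` N n.
Proof.
move=> iN incN.
have leN i j : (i <= j)%N -> N i `<=` N j.
  move=> /subnKC <-; elim: (j - i)%N => [|p IH]; first by rewrite addn0.
  by rewrite addnS; exact: subset_trans IH (incN _).
have iU : ideal [set x | exists i, N i x].
  split=> [|a x y [i hx] [j hy]]; first by exists 0%N; exact: ideal0.
  exists (maxn i j); apply: idealD => //.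
    by apply: idealZl => //; exact: leN (leq_maxl _ _) _ hx.
  exact: leN (leq_maxr _ _) _ hy.
case: (R_noeth iU) => s Us.
have [n hn] : exists n, forall x, x \in s -> N n x.
  have : forall x, x \in s -> exists i, N i x.
    by move=> x xs; have : ideal_gen [set` s] x by [exact: sub_ideal_gen]; rewrite -Us.
  elim: s {Us} => [|x s IH] h; first by exists 0%N.
  case: IH => [y ys|n hn]; first by apply: h; rewrite inE ys orbT.
  case: (h x); first exact: mem_head.
  move=> i hi; exists (maxn i n) => y; rewrite inE => /orP[/eqP->|/hn].
    exact: leN (leq_maxl _ _) _ hi.
  by apply: leN; exact: leq_maxr.
exists n => i x hx.
have : ideal_gen [set` s] x by rewrite -Us; exists i.
by apply: ideal_gen_min => // y; exact: hn.
Qed.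

(** Without a maximal member, choice produces a strictly increasing sequence in [P] above [I0],
    against [ideal_acc]. *)
Lemma ideal_maximal (P : set (set R)) I0 : P `<=` @ideal R -> P I0 ->
  exists I, [/\ P I, I0 `<=` I & forall J, P J -> I `<=` J -> J = I].
Proof.
move=> Pid P0; apply: contrapT => nomax.
have step (I : {I | P I /\ I0 `<=` I}) :
    exists J : {I | P I /\ I0 `<=` I}, sval I `<` sval J.
  apply: contrapT => nJ; apply: nomax; exists (sval I).
  case: I nJ => I [PI I0I] /= nJ; split=> // J PJ IJ.
  apply/seteqP; split=> //; apply: contrapT => nJI; apply: nJ.
  by exists (exist _ J (conj PJ (subset_trans I0I IJ))).
case: (choice step) => f hf.
pose N n := sval (iter n f (exist _ I0 (conj P0 (@subset_refl _ I0)))).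
case: (@ideal_acc N) => [i|i|n /(_ n.+1)].
- by rewrite /N; case: (iter _ _ _) => I [PI _] /=; exact: Pid.
- exact: (hf _).1.
- by move=> h; case: (hf (iter n f (exist _ I0 (conj P0 (@subset_refl _ I0))))).
Qed.

Section Local.
Variable m : set R.
Hypothesis R_local : local_ring m.

Lemma max_ideal : ideal m. Proof. by case: R_local => -[]. Qed.

Lemma max_proper : ~ m 1. Proof. by case: R_local => -[]. Qed.

Lemma notin_max_unit x : ~ m x -> exists y, x * y = 1.
Proof.
move=> nmx; apply: contrapT => nu.
have ix := @scale_ideal x setT idealT.
have n1 : ~ scale x setT 1 by move=> [y _ e]; apply: nu; exists y.
case: (@ideal_maximal [set I | ideal I /\ ~ I 1] (scale x setT)).
- by move=> I [].
- by [].
move=> M [[iM M1] xM maxM].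
suff eM : M = m by apply: nmx; rewrite -eM; apply: xM; exists 1; rewrite ?mulr1.
by apply: R_local.2; split=> // J iJ J1 MJ; exact: maxM.
Qed.

Lemma max_prime x y : m (x * y) -> ~ m x -> m y.
Proof.
move=> mxy /notin_max_unit[x' e]; have -> : y = x' * (x * y) by rewrite mulrA (mulrC x') e mul1r.
exact: idealZl max_ideal mxy.
Qed.

Lemma ideal_cancel_unit K x u : ideal K -> ~ m x -> K (x * u) -> K u.
Proof.
move=> iK /notin_max_unit[x' e] h; have -> : u = x' * (x * u) by rewrite mulrA (mulrC x') e mul1r.
exact: idealZl.
Qed.

Lemma ideal_cancel_1B K x u : ideal K -> m x -> K (u - x * u) -> K u.
Proof.
move=> iK mx h; apply: (@ideal_cancel_unit K (1 - x)) => //; last by rewrite mulrBl mul1r.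
by move=> h1; apply: max_proper; rewrite -(subrK x 1); exact: idealD max_ideal h1 mx.
Qed.

(** Generators of A are eliminated one at a time. Since 1 - r is a unit for r in m, the relation for
    a generator a expresses it through the others modulo B; substituting it into their relations
    leaves the same hypothesis for a shorter list. *)
Lemma nakayama A B : ideal A -> ideal B ->
  A `<=` ideal_add B (ideal_mul m A) -> A `<=` B.
Proof.
move=> iA iB; case: (R_noeth iA) => s As h.
have {h} : forall x, x \in s -> ideal_add B (ideal_mul m (ideal_gen [set` s])) x.
  by move=> x xs; rewrite -As; apply: h; rewrite As; exact: sub_ideal_gen.
rewrite As; move=> {A As iA} h; apply: ideal_gen_min => //.
elim: s h => [|a s IH] h; first by move=> x.
have iM := ideal_mul_ideal m (ideal_gen [set` s]).
have iBM := ideal_add_ideal iB iM.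
have gen_cons z : ideal_gen [set` a :: s] z ->
    exists r, ideal_gen [set` s] (z - r * a).
  have iG := ideal_gen_ideal [set` s].
  apply: (@ideal_gen_min [set` a :: s] [set z | exists r, ideal_gen [set` s] (z - r * a)]).
    split=> [|c x y [r hr] [r' hr']]; first by exists 0; rewrite mul0r subr0; exact: ideal0 iG.
    exists (c * r + r').
    have -> : c * x + y - (c * r + r') * a = c * (x - r * a) + (y - r' * a) by ring.
    exact: idealD iG (idealZl c iG hr) hr'.
  move=> x /=; rewrite inE => /orP[/eqP->|xs].
    by exists 1; rewrite mul1r subrr; exact: ideal0 iG.
  by exists 0; rewrite mul0r subr0; exact: sub_ideal_gen.
have mul_cons z : ideal_mul m (ideal_gen [set` a :: s]) z ->
    exists2 r, m r & ideal_mul m (ideal_gen [set` s]) (z - r * a).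
  have im := max_ideal.
  apply: (@ideal_mul_min _ _
    [set z | exists2 r, m r & ideal_mul m (ideal_gen [set` s]) (z - r * a)]).
    split=> [|c x y [r mr hr] [r' mr' hr']].
      by exists 0; [exact: ideal0|rewrite mul0r subr0; exact: ideal0 iM].
    exists (c * r + r'); first by apply: idealD => //; exact: idealZl.
    have -> : c * x + y - (c * r + r') * a = c * (x - r * a) + (y - r' * a) by ring.
    exact: idealD iM (idealZl c iM hr) hr'.
  move=> x y mx /gen_cons[r hr]; exists (x * r); first exact: idealZr im mx.
  have -> : x * y - x * r * a = x * (y - r * a) by ring.
  exact: mem_ideal_mul.
have red z : ideal_add B (ideal_mul m (ideal_gen [set` a :: s])) z ->
    exists2 r, m r & ideal_add B (ideal_mul m (ideal_gen [set` s])) (z - r * a).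
  move=> [b hb [w /mul_cons[r mr hr] ->]]; exists r => //.
  by exists b => //; exists (w - r * a); rewrite // addrA.
have ha : ideal_add B (ideal_mul m (ideal_gen [set` s])) a.
  case: (red a (h a (mem_head _ _))) => r mr; exact: ideal_cancel_1B.
have sB : [set` s] `<=` B.
  apply: IH => x xs; case: (red x).
    by apply: h; rewrite inE xs orbT.
  move=> r mr hr; rewrite -(subrK (r * a) x); apply: idealD => //; exact: idealZl.
move=> x /=; rewrite inE => /orP[/eqP->|]; last exact: sB.
case: ha => b hb [w hw ->]; apply: idealD => //.
by apply: ideal_mul_min hw => // u v _ hv; apply: idealZl => //; exact: ideal_gen_min hv.
Qed.

End Local.
End Noetherian.
End Ideals.

(** * Length *)

Lemma chain_length_sub (T T' : Type) (P : set (set T)) (P' : set (set T'))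
    (f : set T -> set T') :
  (forall A, P A -> P' (f A)) ->
  (forall A B, P A -> P B -> A `<` B -> f A `<` f B) ->
  chain_lengths P `<=` chain_lengths P'.
Proof.
move=> Pf ltf n [c [Pc ltc]]; exists (f \o c); split=> [i ilen|i iltn] /=.
  exact: Pf (Pc _ ilen).
by apply: ltf; [exact: Pc (ltnW _)|exact: Pc|exact: ltc].
Qed.

(** Repetitions are deleted from a weakly increasing chain; what remains has one step for each
    strict inclusion. *)
Lemma chain_length_steps (T : Type) (P : set (set T)) (d : nat -> set T) n :
  (forall i, (i <= n)%N -> P (d i)) -> (forall i, (i < n)%N -> d i `<=` d i.+1) ->
  chain_lengths P (count (fun i => `[< d i `<` d i.+1 >]) (iota 0 n)).
Proof.
move=> Pd led; set s := count _ _.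
suff [c [Pc ltc _]] : exists c, [/\ forall i, (i <= s)%N -> P (c i),
    forall i, (i < s)%N -> c i `<` c i.+1 & c s = d n] by exists c.
rewrite /s {s}; elim: n Pd led => [|n IH] Pd led.
  by exists d; split=> // i; rewrite leqn0 => /eqP->; exact: Pd.
case: IH => [i le_in|i lt_in|c [Pc ltc cs]]; first exact: Pd (leqW _).
  exact: led (ltnW _).
rewrite -[X in iota 0 X]addn1 iotaD count_cat /= addn0; set s := count _ _ in Pc ltc cs *.
case: asboolP => /= h.
  exists (fun i => if (i <= s)%N then c i else d n.+1); split=> [i|i|].
  - by case: ifP => [/Pc //|_ _]; exact: Pd.
  - rewrite addn1 => lt_is; have lis : (i <= s)%N := lt_is.
    rewrite lis; case: ifP => [|/negbT]; first exact: ltc.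
    rewrite -leqNgt => sli; have -> : i = s by apply/eqP; rewrite eqn_leq lis.
    by rewrite cs.
  - by rewrite addn1 ltnn.
rewrite addn0; exists c; split=> //; rewrite cs; apply/seteqP; split; first exact: led.
by apply: contrapT => h'; apply: h; split; first exact: led.
Qed.

Section Length.
Variable R : comNzRingType.
Implicit Types (A B C J K L : set R) (x y z : R).

(** These are the submodules of A / B, so that [len B A] is the length of A / B. *)
Definition between B A : set (set R) :=
  [set K | [/\ ideal K, B `<=` K & K `<=` A]].

Definition finlen B A := exists N, forall n, chain_lengths (between B A) n -> (n <= N)%N.

(* xget makes this 0 when A / B has infinite length. *)
Definition len B A : nat := xget 0%N (is_max (chain_lengths (between B A))).

Lemma is_max_uniq (S : set nat) n n' : is_max S n -> is_max S n' -> n = n'.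
Proof. by move=> [h h1] [h' h1']; apply/eqP; rewrite eqn_leq (h1' _ h) (h1 _ h'). Qed.

Lemma chain_length0 B A : ideal B -> B `<=` A -> chain_lengths (between B A) 0%N.
Proof. by move=> iB BA; exists (fun=> B); split=> // i _; split. Qed.

Lemma lenP B A : ideal B -> B `<=` A -> finlen B A ->
  is_max (chain_lengths (between B A)) (len B A).
Proof.
move=> iB BA [N hN].
have [n hn] : exists n, is_max (chain_lengths (between B A)) n.
  by apply: bounded_max hN; exists 0%N; exact: chain_length0.
exact: (@xgetPex _ 0%N (is_max (chain_lengths (between B A))) (ex_intro _ n hn)).
Qed.

Lemma len_eq B A l : is_max (chain_lengths (between B A)) l -> len B A = l.
Proof.
move=> h; apply: (is_max_uniq _ h).
exact: (@xgetPex _ 0%N (is_max _) (ex_intro _ l h)).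
Qed.

Lemma finlen_max B A l : is_max (chain_lengths (between B A)) l -> finlen B A.
Proof. by move=> [_ h]; exists l. Qed.

Lemma len_ge B A n : ideal B -> B `<=` A -> finlen B A ->
  chain_lengths (between B A) n -> (n <= len B A)%N.
Proof. by move=> iB BA fl; case: (lenP iB BA fl) => _; exact. Qed.

Lemma finlen_sub B A B' A' : B `<=` B' -> A' `<=` A -> finlen B A -> finlen B' A'.
Proof.
move=> BB AA [N hN]; exists N => n h; apply: hN; move: n h.
apply: (@chain_length_sub _ _ _ _ id) => // K [iK h1 h2]; split=> //.
  exact: subset_trans BB h1.
exact: subset_trans h2 AA.
Qed.

(** Concatenating chains at C gives one inequality. For the other, the modular law says that each
    strict step of a chain stays strict after intersection with C or after addition of C. *)
Lemma lenD B C A : ideal B -> ideal C -> ideal A -> B `<=` C -> C `<=` A -> finlen B A ->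
  len B A = (len B C + len C A)%N.
Proof.
move=> iB iC iA BC CA fl.
have BA := subset_trans BC CA.
have flC := finlen_sub (@subset_refl _ B) CA fl.
have flC' := finlen_sub BC (@subset_refl _ A) fl.
apply/eqP; rewrite eqn_leq; apply/andP; split; last first.
  apply: len_ge => //.
  have [[c [Pc ltc]] _] := lenP iB BC flC.
  have [[c' [Pc' ltc']] _] := lenP iC CA flC'.
  set p := len B C in Pc ltc *; set q := len C A in Pc' ltc' *.
  exists (fun i => if (i < p)%N then c i else c' (i - p)%N); split=> i ile.
    case: ifP => [lip|].
      case: (Pc i (ltnW lip)) => ? ? ?; split=> //; exact: subset_trans CA.
    have /Pc'[? ? ?] : (i - p <= q)%N by rewrite leq_subLR.
    by move=> _; split=> //; apply: subset_trans BC _.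
  have [lip|lpi] := ltnP i p.
    case: ifP => [h|/negbT]; first exact: ltc.
    rewrite -leqNgt => pl; have -> : (i.+1 - p)%N = 0%N by apply/eqP; rewrite subn_eq0.
    case: (ltc i lip) => h1 h2; have [_ _ h3] := Pc _ lip.
    have [_ h4 _] := Pc' 0%N (leq0n _).
    split; first by move=> x /h1 /h3 /h4.
    by move=> h5; apply: h2 => x /h3 /h4 /h5.
  rewrite ltnNge leqW //= subSn //; apply: ltc'.
  by rewrite ltn_subLR.
have [[c [Pc ltc]] _] := lenP iB BA fl.
set n := len B A in Pc ltc *.
pose a i := c i `&` C; pose b i := ideal_add (c i) C.
have lec i : (i < n)%N -> c i `<=` c i.+1 by move=> /ltc[].
have ha := @chain_length_steps _ (between B C) a n.
have hb := @chain_length_steps _ (between C A) b n.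
apply: (@leq_trans (count (fun i => `[< a i `<` a i.+1 >]) (iota 0 n) +
  count (fun i => `[< b i `<` b i.+1 >]) (iota 0 n))); last first.
  apply: leq_add; apply: len_ge => //.
    apply: ha => [i /Pc[ic Bc cA]|i /lec h x []]; last by move=> /h.
    split; [|by move=> x Bx; split; [exact: Bc|exact: BC]|by move=> x []].
    split=> [|r x y [h1 h2] [h3 h4]]; first by split; exact: ideal0.
    by split; apply: idealD => //; exact: idealZl.
  apply: hb => [i /Pc[ic Bc cA]|i /lec h]; last exact: ideal_addS.
  split; [exact: ideal_add_ideal|exact: ideal_add_subr|].
  by move=> _ [x /cA hx [y /CA hy ->]]; exact: idealD.
rewrite -count_predUI; apply: leq_trans (leq_addr _ _).
rewrite (_ : count _ _ = n) // -[RHS](size_iota 0 n) -count_predT.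
apply: eq_in_count => i.
rewrite mem_iota /= add0n => lin; apply/orP; apply: contrapT.
move=> /not_orP[/negP/asboolPn na /negP/asboolPn nb].
case: (ltc i lin) => _; apply=> x hx.
have ab : b i.+1 `<=` b i.
  by apply: contrapT => h; apply: nb; split=> //; apply: ideal_addS => //; exact: lec.
have aa : a i.+1 `<=` a i.
  by apply: contrapT => h; apply: na; split=> // y [/(lec _ lin)].
have [ic _ _] := Pc _ (ltnW lin); have [ic' _ _] := Pc _ lin.
have [y hy [z hz e]] : b i x by apply: ab; exact: ideal_add_subl.
rewrite e; apply: idealD => //.
suff [] : a i z by [].
apply: aa; split=> //; have -> : z = x - y by rewrite e addrC addKr.
by apply: idealB => //; exact: lec.
Qed.

Lemma len_gt0 B A : ideal A -> ideal B -> B `<=` A -> finlen B A -> ~ (A `<=` B) ->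
  (0 < len B A)%N.
Proof.
move=> iA iB BA fl AB; apply: len_ge => //.
exists (fun i => if i == 0%N then B else A).
by split=> [[|i] _|[|i] //]; split.
Qed.

Lemma len_le_eq B C A : ideal A -> ideal B -> ideal C -> B `<=` C -> C `<=` A ->
  finlen B A -> (len B A <= len B C)%N -> A `<=` C.
Proof.
move=> iA iB iC BC CA fl; rewrite (lenD iB iC iA) // -[X in (_ <= X)%N]addn0 leq_add2l.
move=> h; apply: contrapT => AC.
by have := len_gt0 iA iC CA (finlen_sub BC (@subset_refl _ A) fl) AC; rewrite ltnNge h.
Qed.

Lemma len_le1 K A b : ideal A -> ideal K -> K `<=` A -> finlen K A ->
  (len K A <= 1)%N -> A b -> ~ K b -> A `<=` addx K b.
Proof.
move=> iA iK KA fl l1 Ab Kb.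
have iKb := addx_ideal b iK; have KKb := @sub_addx _ K b.
have KbA : addx K b `<=` A by exact: addx_min.
apply: (@len_le_eq K) => //; apply: leq_trans l1 _; apply: len_gt0 => //.
  exact: finlen_sub KbA fl.
by move=> /(_ b (mem_addx _ iK)).
Qed.

(* Multiplication by x makes A / ((K : x) /\ A) isomorphic to (K + xA) / K. *)
Lemma chain_lengths_mul K A x : ideal K -> ideal A ->
  chain_lengths (between K (ideal_add K (scale x A))) =
  chain_lengths (between (colon K x `&` A) A).
Proof.
move=> iK iA; apply/seteqP; split.
  apply: (@chain_length_sub _ _ _ _ (fun L => colon L x `&` A)).
    move=> L [iL KL LKA]; have iC := colon_ideal x iL; split; last by move=> u [].
      split=> [|a u v [h1 h2] [h3 h4]].
        by split; exact: ideal0.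
      split; last exact: idealD iA (idealZl a iA h2) h4.
      exact: idealD iC (idealZl a iC h1) h3.
    by move=> u [/KL h1 h2].
  move=> L L' [iL KL _] [iL' KL' LKA'] [LL LL']; split.
    by move=> u [/LL].
  move=> h; apply: LL' => z hz.
  have [k /KL Lk [_ [a Aa <-] e]] := LKA' z hz; rewrite e; apply: idealD => //.
  apply: (h a _).1; split=> //.
  by rewrite /colon /= -(addKr k (x * a)) -e; apply: idealD => //; apply: idealN => //; exact: LL.
apply: (@chain_length_sub _ _ _ _ (fun L => ideal_add K (scale x L))).
  move=> L [iL KL LA]; split; first by apply: ideal_add_ideal => //; exact: scale_ideal.
    by apply: ideal_add_subl; exact: scale_ideal.
  by apply: ideal_addS => //; apply: scale_min => a /LA; exact: mem_scale.
move=> L L' [iL KL LA] [iL' KL' LA'] [LL LL']; split.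
  by apply: ideal_addS => //; apply: scale_min => a /LL; exact: mem_scale.
move=> h; apply: LL' => z hz.
have [|k Kk [_ [l Ll <-] e]] := h (x * z).
  by apply: (ideal_add_subr iK); exact: mem_scale.
rewrite -(subrK l z); apply: idealD => //; apply: KL; split.
  by rewrite /colon /= mulrBr e addrK.
by apply: idealB => //; [exact: LA'|exact: LA].
Qed.

Lemma len_mul K A x : ideal K -> ideal A ->
  len K (ideal_add K (scale x A)) = len (colon K x `&` A) A.
Proof. by move=> iK iA; rewrite /len chain_lengths_mul. Qed.

Fixpoint spanx K (v : nat -> R) q :=
  if q is q'.+1 then addx (spanx K v q') (v q') else K.

Lemma spanx_ideal K v q : ideal K -> ideal (spanx K v q).
Proof. by move=> iK; elim: q => //= q IH; exact: addx_ideal. Qed.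

Lemma spanxP K v q z : ideal K -> spanx K v q z ->
  exists c : nat -> R, K (z - \sum_(j < q) c j * v j).
Proof.
move=> iK; elim: q z => [|q IH] z /=; first by exists (fun=> 0); rewrite big_ord0 subr0.
move=> /addxP[w /IH[c hc] [r ->]].
exists (fun j => if (j < q)%N then c j else r); rewrite big_ord_recr /= ltnn.
rewrite (eq_bigr (fun j : 'I_q => c j * v j)) => [|j _]; last by rewrite ltn_ord.
by rewrite (_ : _ - _ = w - \sum_(j < q) c j * v j) //; ring.
Qed.

(** * Linear independence over the residue field *)

Section Independence.
Variable m : set R.
Hypotheses (R_noeth : noetherian R) (R_local : local_ring m).

(** For v_i in A with m A inside K, this is linear independence in the vector space A / K over R /
    m, with coefficients kept in R. *)
Definition indep K q (v : nat -> R) := forall c : nat -> R,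
  K (\sum_(i < q) c i * v i) -> forall i, (i < q)%N -> m (c i).

Lemma indep_mod K q v v' : ideal K -> (forall i, (i < q)%N -> K (v i - v' i)) ->
  indep K q v -> indep K q v'.
Proof.
move=> iK e h c hc; apply: h.
have -> : \sum_(i < q) c i * v i =
    \sum_(i < q) c i * v' i + \sum_(i < q) c i * (v i - v' i).
  by rewrite -big_split /=; apply: eq_bigr => i _; rewrite mulrBr addrC subrK.
by apply: idealD => //; apply: ideal_sum => // i _; apply: idealZl => //; exact: e.
Qed.

Lemma indep_notin_spanx K q v : ideal K -> indep K q.+1 v -> ~ spanx K v q (v q).
Proof.
move=> iK h /(spanxP iK)[c hc].
have : m 1; last exact: max_proper R_local.
have := h (fun j => if (j < q)%N then - c j else 1) _ q (ltnSn q).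
rewrite ltnn; apply; rewrite big_ord_recr /= ltnn mul1r addrC.
rewrite (eq_bigr (fun j : 'I_q => - (c j * v j))) => [|j _]; last by rewrite ltn_ord mulNr.
by rewrite sumrN.
Qed.

Lemma indep_le K q q' v : ideal K -> (q <= q')%N -> indep K q' v -> indep K q v.
Proof.
move=> iK le_qq h c hc i iq.
have := h (fun j => if (j < q)%N then c j else 0) _ i (leq_trans iq le_qq); rewrite iq; apply.
rewrite -(big_mkord xpredT (fun j => (if (j < q)%N then c j else 0) * v j)).
rewrite (@big_cat_nat _ _ _ q) //= [X in _ + X]big1_seq ?addr0; last first.
  move=> j; rewrite mem_index_iota => /andP[_ /andP[qj _]].
  by rewrite ltnNge qj mul0r.
rewrite big_mkord (eq_bigr (fun j : 'I_q => c j * v j)) // => j _.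
by rewrite ltn_ord.
Qed.

(** The partial spans K + (v_0, ..., v_(i-1)) form a strict chain. *)
Lemma indep_len K A q v : ideal K -> ideal A -> K `<=` A -> finlen K A ->
  (forall i, (i < q)%N -> A (v i)) -> indep K q v -> (q <= len K A)%N.
Proof.
move=> iK iA KA fl Av h; apply: len_ge => //; exists (spanx K v); split=> i iq.
  split; first exact: spanx_ideal.
    by elim: i {iq} => //= i IH; exact: subset_trans IH (@sub_addx _ _ _).
  elim: i iq => //= i IH iq; apply: addx_min => //; [exact: IH (ltnW _)|exact: Av].
split; first exact: sub_addx.
move=> /(_ (v i)) h'; apply: (@indep_notin_spanx K i v iK (indep_le iK iq h)).
by apply: h'; apply: mem_addx; exact: spanx_ideal.
Qed.

(** One vector is taken from each step of a longest chain. In a relation, a last coefficient outside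
    m would be a unit and pull its vector down into the previous member. *)
Lemma indep_ex K A : ideal K -> ideal A -> ideal_mul m A `<=` K -> K `<=` A -> finlen K A ->
  exists v, (forall i, (i < len K A)%N -> A (v i)) /\ indep K (len K A) v.
Proof.
move=> iK iA mA KA fl; have [[c [Pc ltc]] _] := lenP iK KA fl.
set n := len K A in Pc ltc *.
have : forall i, exists x, (i < n)%N -> c i.+1 x /\ ~ c i x.
  move=> i; have [/ltc[_ h]|] := ltnP i n; last by exists 0.
  apply: contrapT => nex; apply: h => x cx; apply: contrapT => nx; apply: nex.
  by exists x.
move=> /choice[v hv].
have vA i : (i < n)%N -> A (v i).
  by move=> lin; have [_ _] := Pc _ lin; apply; exact: (hv i lin).1.
have lec i j : (i <= j)%N -> (j <= n)%N -> c i `<=` c j.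
  move=> /subnKC <-; elim: (j - i)%N => [|p IH]; first by rewrite addn0 => _ x.
  rewrite addnS => h; apply: subset_trans (IH (ltnW h)) _; exact: (ltc _ h).1.
exists v; split=> //.
suff h q : (q <= n)%N -> indep K q v by exact: h.
elim: q => [|q IH] qn d // hd.
have mq : m (d q).
  apply: contrapT => nm; have [iq Kq _] := Pc q (ltnW qn); apply: (hv q qn).2.
  apply: (ideal_cancel_unit R_noeth R_local iq nm).
  move/Kq: hd; rewrite big_ord_recr /= addrC; apply: ideal_addr => //.
  apply: ideal_sum => // j _; apply: idealZl => //.
  apply: lec (hv j (ltn_trans (ltn_ord j) qn)).1; [exact: ltn_ord|exact: ltnW].
move=> i; rewrite ltnS leq_eqVlt => /orP[/eqP-> //|]; apply: IH; first exact: ltnW.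
move: hd; rewrite big_ord_recr; apply: ideal_addr => //; apply: mA.
by apply: mem_ideal_mul => //; exact: vA.
Qed.

End Independence.
End Length.

(** * Noetherian subrings *)

Section NoetherianSubring.
Variable A : comNzRingType.
Implicit Types (S N : set A) (a c f u x : A).

(** The Rees algebra will be a subset of R[X], so rings are treated here as subsets of an ambient
    ring: [submod S] describes the ideals of S, and [noeth_sub S] the ascending chain condition on
    them. *)
Definition subring S := S 1 /\ (forall x y, S x -> S y -> S (x - y)) /\
  (forall x y, S x -> S y -> S (x * y)).

Definition submod S N := [/\ N `<=` S, N 0 & forall a x y, S a -> N x -> N y -> N (a * x + y)].

Definition noeth_sub S := forall N : nat -> set A, (forall i, submod S (N i)) ->
  (forall i, N i `<=` N i.+1) -> exists n, forall i, N i `<=` N n.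

Lemma subring0 S : subring S -> S 0.
Proof. by move=> [S1 [SB _]]; rewrite -(subrr 1); exact: SB. Qed.

Lemma subringN S x : subring S -> S x -> S (- x).
Proof. by move=> sS hx; rewrite -sub0r; apply: sS.2.1 => //; exact: subring0. Qed.

Lemma subringD S x y : subring S -> S x -> S y -> S (x + y).
Proof. by move=> sS hx hy; rewrite -(opprK y); apply: sS.2.1 => //; exact: subringN. Qed.

Lemma subringM S x y : subring S -> S x -> S y -> S (x * y).
Proof. by move=> [_ [_]]; apply. Qed.

Lemma subringX S x n : subring S -> S x -> S (x ^+ n).
Proof.
move=> sS hx; elim: n => [|n IH]; first by case: sS.
by rewrite exprS; exact: subringM.
Qed.

Lemma subring_sum S (T : Type) (r : seq T) (P : pred T) (F : T -> A) :
  subring S -> (forall i, P i -> S (F i)) -> S (\sum_(i <- r | P i) F i).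
Proof.
move=> sS h; apply: (big_ind S) => //; first exact: subring0.
by move=> x y; exact: subringD.
Qed.

Lemma submodD S N x y : subring S -> submod S N -> N x -> N y -> N (x + y).
Proof. by move=> [S1 _] [_ _ h] hx hy; rewrite -(mul1r x); exact: h. Qed.

Lemma submodM S N a x : submod S N -> S a -> N x -> N (a * x).
Proof. by move=> [_ N0 h] ha hx; rewrite -(addr0 (a * x)); exact: h. Qed.

Lemma submodN S N x : subring S -> submod S N -> N x -> N (- x).
Proof.
move=> sS sN hx; rewrite -mulN1r; apply: submodM => //; first exact: sN.
by apply: subringN => //; case: sS.
Qed.

Lemma submodB S N x y : subring S -> submod S N -> N x -> N y -> N (x - y).
Proof. by move=> sS sN hx hy; apply: (submodD sS sN) => //; exact: (submodN sS sN). Qed.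

Lemma submod_sum S N (T : Type) (r : seq T) (P : pred T) (F : T -> A) :
  subring S -> submod S N -> (forall i, P i -> N (F i)) -> N (\sum_(i <- r | P i) F i).
Proof.
move=> sS sN h; apply: (big_ind N) => //; first by case: sN.
by move=> x y; exact: submodD sS sN.
Qed.

(** The element a may be algebraic over S, so i bounds the degree of an expression and is not
    attached to its value. *)
Definition polyval_lt S a i : set A :=
  [set f | exists2 c : nat -> A, (forall j, S (c j)) & f = \sum_(j < i) c j * a ^+ j].

Definition adjoin S a : set A := [set f | exists i, polyval_lt S a i f].

Lemma polyval_ltD S a i b x y : subring S -> S b ->
  polyval_lt S a i x -> polyval_lt S a i y -> polyval_lt S a i (b * x + y).
Proof.
move=> sS Sb [c Sc ->] [d Sd ->]; exists (fun j => b * c j + d j).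
  by move=> j; apply: subringD => //; exact: subringM.
by rewrite big_distrr -big_split /=; apply: eq_bigr => j _; ring.
Qed.

Lemma polyval_lt_widen S a i j : subring S -> (i <= j)%N ->
  polyval_lt S a i `<=` polyval_lt S a j.
Proof.
move=> sS /subnKC <-; elim: (j - i)%N => [|p IH] f hf; first by rewrite addn0.
have [c Sc ->] := IH f hf; rewrite addnS.
exists (fun l => if (l < i + p)%N then c l else 0).
  by move=> l; case: ifP => // _; exact: subring0.
rewrite big_ord_recr /= ltnn mul0r addr0; apply: eq_bigr => l _; by rewrite ltn_ord.
Qed.

Lemma polyval_ltSE S a i f : polyval_lt S a i.+1 f ->
  exists s g, [/\ S s, polyval_lt S a i g & f = s * a ^+ i + g].
Proof.
move=> [c Sc ->]; exists (c i), (\sum_(j < i) c j * a ^+ j); split=> //; first by exists c.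
by rewrite big_ord_recr addrC.
Qed.

Lemma polyval_ltMa S a i f : subring S -> polyval_lt S a i f -> polyval_lt S a i.+1 (a * f).
Proof.
move=> sS [c Sc ->]; exists (fun l => if l is l'.+1 then c l' else 0).
  by case=> //; exact: subring0.
rewrite big_ord_recl mul0r add0r big_distrr /=; apply: eq_bigr => l _.
by rewrite exprS; ring.
Qed.

Lemma sub_adjoin S a : subring S -> S `<=` adjoin S a.
Proof.
by move=> sS x Sx; exists 1%N, (fun=> x) => //; rewrite big_ord1 mulr1.
Qed.

Lemma mem_adjoin S a : subring S -> adjoin S a a.
Proof.
move=> sS; exists 2%N; rewrite -[a in X in _ X]mulr1.
apply: polyval_ltMa => //; exists (fun=> 1); first by move=> _; case: sS.
by rewrite big_ord1 mulr1.
Qed.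

Lemma adjoin_subring S a : subring S -> subring (adjoin S a).
Proof.
move=> sS; have S1 : S 1 by case: sS.
have aD b f g : S b -> adjoin S a f -> adjoin S a g -> adjoin S a (b * f + g).
  move=> Sb [i hf] [j hg]; exists (maxn i j); apply: polyval_ltD => //.
    exact: polyval_lt_widen (leq_maxl _ _) _ hf.
  exact: polyval_lt_widen (leq_maxr _ _) _ hg.
split; first exact: sub_adjoin.
split=> [x y hx hy|x y [i hx] hy].
  by rewrite addrC -mulN1r; apply: aD => //; exact: subringN.
elim: i x hx => [|i IH] x.
  by move=> [c _ ->]; rewrite big_ord0 mul0r; apply: sub_adjoin => //; exact: subring0.
move=> /polyval_ltSE[s [g [Ss hg ->]]]; rewrite mulrDl -mulrA; apply: aD => //; last exact: IH.
elim: (i) => [|l IHl]; first by rewrite mul1r.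
by rewrite exprS -mulrA; case: IHl => q hq; exists q.+1; exact: polyval_ltMa.
Qed.

(* Hilbert's basis theorem: an S[a]-submodule is determined by the S-submodules
   formed by its leading coefficients. *)
Theorem noeth_adjoin S a : subring S -> noeth_sub S -> noeth_sub (adjoin S a).
Proof.
move=> sS nS N sN incN; have sSa := adjoin_subring a sS.
pose L i (M : set A) := [set s | S s /\ exists2 f, polyval_lt S a i f & M (s * a ^+ i + f)].
have sL i M : submod (adjoin S a) M -> submod S (L i M).
  move=> sM; split=> [s []//||b s t Sb [Ss [f hf Mf]] [St [g hg Mg]]].
    split; first exact: subring0.
    exists 0; last by rewrite mul0r addr0; case: sM.
    by exists (fun=> 0); [move=> _; exact: subring0|rewrite big1 // => j _; rewrite mul0r].
  split; first by apply: subringD => //; exact: subringM.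
  exists (b * f + g); first exact: polyval_ltD.
  have -> : (b * s + t) * a ^+ i + (b * f + g) = b * (s * a ^+ i + f) + (t * a ^+ i + g) by ring.
  by case: sM => _ _; apply => //; exact: sub_adjoin.
have LS i M : submod (adjoin S a) M -> L i M `<=` L i.+1 M.
  move=> sM s [Ss [f hf Mf]]; split=> //; exists (a * f); first exact: polyval_ltMa.
  have -> : s * a ^+ i.+1 + a * f = a * (s * a ^+ i + f) by rewrite exprS; ring.
  by apply: submodM sM _ Mf; exact: mem_adjoin.
have Lle i j M : submod (adjoin S a) M -> (i <= j)%N -> L i M `<=` L j M.
  move=> sM /subnKC <-; elim: (j - i)%N => [|p IH]; first by rewrite addn0.
  by rewrite addnS; apply: subset_trans IH _; exact: LS.
have Lsub i M M' : M `<=` M' -> L i M `<=` L i M'.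
  by move=> MM s [Ss [f hf Mf]]; split=> //; exists f => //; exact: MM.
have Nle i j : (i <= j)%N -> N i `<=` N j.
  move=> /subnKC <-; elim: (j - i)%N => [|p IH]; first by rewrite addn0.
  by rewrite addnS; apply: subset_trans IH _; exact: incN.
(* The leading modules L i (N n) grow in both indices. Stabilising the diagonal settles all i >= n0;
   the finitely many smaller i are settled separately. *)
have [n0 hn0] : exists n, forall i, L i (N i) `<=` L n (N n).
  apply: (nS (fun i => L i (N i))) => i; first exact: sL.
  by apply: subset_trans (LS _ _ (sN _)) _; exact: Lsub.
have big i n : (n0 <= i)%N -> L i (N n) `<=` L i (N n0).
  move=> ni; apply: subset_trans (Lle _ (maxn i n) _ (sN n) (leq_maxl _ _)) _.
  apply: subset_trans (Lsub _ _ (N (maxn i n)) (Nle _ _ (leq_maxr _ _))) _.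
  by apply: subset_trans (hn0 _) _; exact: Lle.
have [n1 hn1] : exists n1, forall i n, L i (N n) `<=` L i (N n1).
  have small q : exists n1, (n0 <= n1)%N /\
      forall i, (i < q)%N -> forall n, L i (N n) `<=` L i (N n1).
    elim: q => [|q [n1 [n01 IH]]]; first by exists n0.
    have [n2 h2] : exists n2, forall n, L q (N n) `<=` L q (N n2).
      by apply: (nS (fun n => L q (N n))) => i; [exact: sL|exact: Lsub].
    exists (maxn n1 n2); split; first exact: leq_trans n01 (leq_maxl _ _).
    move=> i; rewrite ltnS leq_eqVlt => /orP[/eqP->|iq] n.
      by apply: subset_trans (h2 n) _; apply: Lsub; apply: Nle; exact: leq_maxr.
    by apply: subset_trans (IH i iq n) _; apply: Lsub; apply: Nle; exact: leq_maxl.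
  have [n1 [n01 hn1]] := small n0.
  exists n1 => i n; have [ni|/hn1//] := leqP n0 i.
  by apply: subset_trans (big i n ni) _; apply: Lsub; exact: Nle.
exists n1 => n f hf; have [l hl] : adjoin S a f by case: (sN n) => + _ _; apply.
have n1n : (n1 <= maxn n n1)%N := leq_maxr _ _.
have {}hf : N (maxn n n1) f by apply: Nle hf; exact: leq_maxl.
(* Descent on the degree bound: an element of N n1 with the same leading coefficient is
   subtracted. *)
elim: l f hl hf => [|l IH] f hl hf.
  by case: hl => c _ ->; rewrite big_ord0; case: (sN n1).
case/polyval_ltSE: hl => s [g [Ss hg ef]].
have [_ [h hh Nh]] : L l (N n1) s by apply: (hn1 l (maxn n n1)); split=> //; exists g; rewrite -?ef.
rewrite -(subrK (s * a ^+ l + h) f); apply: (submodD sSa (sN n1)) => //.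
have e : f - (s * a ^+ l + h) = (-1) * h + g by rewrite ef; ring.
apply: IH.
  rewrite e; apply: polyval_ltD => //; apply: subringN => //; by case: sS.
by apply: (submodB sSa (sN _)) => //; exact: Nle n1n _ Nh.
Qed.

End NoetherianSubring.

(** * The Rees algebra *)

Section Rees.
Variable R : comNzRingType.
Variable I : set R.
Hypotheses (R_noeth : noetherian R) (iI : ideal I).

Definition rees : set {poly R} := [set f | forall n, ideal_exp I n f`_n].

Lemma rees_subring : subring rees.
Proof.
split=> [n|]; first by rewrite coef1; case: n => // n; exact: ideal0 (ideal_exp_ideal _ _).
split=> f g hf hg n; first by rewrite coefB; exact: idealB (ideal_exp_ideal _ _) (hf n) (hg n).
rewrite coefM; apply: ideal_sum => [|i _]; first exact: ideal_exp_ideal.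
rewrite -[X in ideal_exp I X](@subnKC i n); last by rewrite -ltnS.
exact: mem_ideal_expD.
Qed.

Lemma noeth_const : noeth_sub [set f : {poly R} | exists r, f = r%:P].
Proof.
move=> N sN incN.
case: (@ideal_acc _ R_noeth (fun i => [set r | N i r%:P])) => [i|i r /=|n hn].
- split=> [|a x y hx hy] /=; first by rewrite polyC0; case: (sN i).
  by rewrite polyCD polyCM; case: (sN i) => _ _; apply=> //; exists a.
- exact: incN.
exists n => i f hf; have [r er] : exists r, f = r%:P by case: (sN i) => + _ _; apply.
by move: hf; rewrite er; exact: hn.
Qed.

Lemma adjoin_min (A : comNzRingType) (S T : set A) a :
  subring T -> S `<=` T -> T a -> adjoin S a `<=` T.
Proof.
move=> sT ST Ta f [i [c Sc ->]]; apply: subring_sum => // j _.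
by apply: subringM => //; [exact: ST|exact: subringX].
Qed.

Lemma rees_noeth : noeth_sub rees.
Proof.
have [c ec] := R_noeth iI.
pose S0 : set {poly R} := [set f | exists r, f = r%:P].
have sS0 : subring S0.
  split; first by exists 1.
  by split=> _ _ [r ->] [s ->]; [exists (r - s); rewrite polyCB|exists (r * s); rewrite polyCM].
(* S is R[c_1 X, ..., c_q X], obtained by adjoining one element at a time. Its minimality is carried
   along, so that equality with [rees] is proved only once. *)
suff [S [sS nS S0S Sc Smin]] : exists S, [/\ subring S, noeth_sub S, S0 `<=` S,
    forall x, x \in c -> S (x *: 'X) &
    forall T, subring T -> S0 `<=` T -> (forall x, x \in c -> T (x *: 'X)) -> S `<=` T].
  suff -> : rees = S by [].
  have monoS n : forall u, ideal_exp I n u -> S (u *: 'X^n).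
    elim: n => [|n IH] u hu.
      by rewrite expr0 -mul_polyC mulr1; apply: S0S; exists u.
    have sub p (w : R) : ideal [set z | S ((w * z) *: 'X^p)].
      split=> [|a x y hx hy] /=; first by rewrite mulr0 scale0r; exact: subring0.
      rewrite mulrDr mulrCA scalerDl -(scalerA a) -(mul_polyC a).
      by apply: (subringD sS _ hy); apply: (subringM sS _ hx); apply: S0S; exists a.
    rewrite -(mul1r u); apply: (ideal_mul_min (sub n.+1 1) _ hu).
    move=> x y Ix hy /=; rewrite mul1r mulrC; rewrite ec in Ix.
    apply: (ideal_gen_min (sub n.+1 y) _ Ix) => z zc /=.
    have -> : (y * z) *: 'X^(n.+1) = (z *: 'X) * (y *: 'X^n) :> {poly R}.
      by rewrite -scalerAl -scalerAr scalerA exprS mulrC.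
    by apply: subringM => //; [exact: Sc|exact: IH].
  apply/seteqP; split=> [f hf|].
    rewrite -[f]coefK poly_def; apply: subring_sum => // i _; exact: monoS.
  apply: Smin; first exact: rees_subring.
    move=> _ [r ->] n; rewrite coefC; case: eqP => [->//|_].
    exact: ideal0 (ideal_exp_ideal _ _).
  move=> x xc n; rewrite coefZ coefX; case: eqP => [->|_]; last first.
    by rewrite mulr0; exact: ideal0 (ideal_exp_ideal _ _).
  by rewrite mulr1 ideal_exp1 // ec; exact: sub_ideal_gen.
elim: {ec} c => [|a c [S [sS nS S0S Sc Smin]]].
  by exists S0; split=> //; exact: noeth_const.
exists (adjoin S (a *: 'X)); split; [exact: adjoin_subring|exact: noeth_adjoin|..].
- by apply: subset_trans S0S _; exact: sub_adjoin.
- move=> x; rewrite inE => /orP[/eqP->|/Sc h]; [exact: mem_adjoin|exact: sub_adjoin].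
move=> T sT S0T Tc; apply: adjoin_min => //; last by apply: Tc; exact: mem_head.
by apply: Smin => // x xc; apply: Tc; rewrite inE xc orbT.
Qed.

(* The graded ideals of the Rees algebra, given by their components. *)
Definition rees_family (L : nat -> set R) := forall n,
  [/\ ideal (L n), L n `<=` ideal_exp I n & forall a u, I a -> L n u -> L n.+1 (a * u)].

Definition family_set (L : nat -> set R) : set {poly R} := [set f | forall n, L n f`_n].

Lemma rees_familyM L i n a u : rees_family L -> ideal_exp I i a -> L n u -> L (i + n)%N (a * u).
Proof.
move=> hL; elim: i a => [|i IH] a ha hu; first by apply: idealZl => //; case: (hL n).
have iL : ideal (colon (L (i.+1 + n)%N) u) by apply: colon_ideal; case: (hL (i.+1 + n)%N).
rewrite mulrC; apply: (ideal_mul_min iL _ ha) => x y Ix hy.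
by rewrite /colon /= mulrC -mulrA addSn; case: (hL (i + n)%N) => _ _; apply => //; exact: IH.
Qed.

Lemma family_submod L : rees_family L -> submod rees (family_set L).
Proof.
move=> hL; split=> [f hf n|n|f g h hf hg hh n].
- by case: (hL n) => _ + _; apply; exact: hf.
- by rewrite coef0; apply: ideal0; case: (hL n).
have iL : ideal (L n) by case: (hL n).
rewrite coefD coefM; apply: idealD => //; apply: ideal_sum => // i _.
rewrite -[X in L X](@subnKC i n); last by rewrite -ltnS.
exact: rees_familyM.
Qed.

Lemma family_acc (F : nat -> nat -> set R) : (forall j, rees_family (F j)) ->
  (forall j n, F j n `<=` F j.+1 n) -> exists r, forall j n, F j n `<=` F r n.
Proof.
move=> hF incF.
case: (@rees_noeth (fun j => family_set (F j))) => [j|j f hf n|r hr].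
- exact: family_submod.
- exact: incF.
exists r => j n u hu.
have : family_set (F j) (u *: 'X^n).
  move=> i; rewrite coefZ coefXn; case: eqP => [->|_]; first by rewrite mulr1.
  by rewrite mulr0; apply: ideal0; case: (hF j i).
by move=> /hr /(_ n); rewrite coefZ coefXn eqxx mulr1.
Qed.

(** [F j] is the graded ideal generated by the components of L of degree at most j: above degree j
    it is I^(n-j) L_j, since L_j absorbs I^(j-i) L_i. These ideals increase to L, hence
    stabilise. *)
Lemma family_gen L : rees_family L ->
  exists r, forall p, L (r + p)%N `<=` ideal_mul (ideal_exp I p) (L r).
Proof.
move=> hL; have iL n : ideal (L n) by case: (hL n).
pose F j n := if (n <= j)%N then L n else ideal_mul (ideal_exp I (n - j)) (L j).
have FL j p : F j (j + p.+1)%N = ideal_mul (ideal_exp I p.+1) (L j).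
  by rewrite /F {1}addnS ltnNge leq_addr /= addKn.
have mulL j p : ideal_mul (ideal_exp I p) (L j) `<=` L (p + j)%N.
  by apply: ideal_mul_min => // a u; exact: rees_familyM.
case: (@family_acc F) => [j n|j n|r hr].
- rewrite /F; case: (leqP n j) => nj.
    split=> //; first by case: (hL n).
    move=> a u Ia hu; have hau : L n.+1 (a * u) by case: (hL n) => _ _; apply.
    case: ifP => // h; have -> : n = j by apply/eqP; rewrite eqn_leq nj /= leqNgt h.
    rewrite subSnn; apply: mem_ideal_mul; first exact: mem_ideal_exp1.
    by rewrite (_ : j = n) //; apply/eqP; rewrite eqn_leq nj leqNgt h.
  split; first exact: ideal_mul_ideal.
    have nj' := ltnW nj.
    apply: subset_trans (@mulL _ _) _; rewrite subnK //; by case: (hL n).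
  move=> a u Ia hu; rewrite leqNgt ltnS (ltnW nj) /= subSn ?(ltnW nj) //.
  apply: (ideal_mul_min (colon_ideal a (ideal_mul_ideal _ _)) _ hu) => x y hx hy.
  by rewrite /colon /= mulrA; apply: mem_ideal_mul => //; exact: mem_ideal_mul.
- rewrite /F; case: (leqP n j) => nj; first by rewrite leqW.
  case: ifP => [nj1|/negbT]; first by apply: subset_trans (@mulL _ _) _; rewrite subnK // ltnW.
  rewrite -ltnNge => j1n; have -> : (n - j)%N = (n - j.+1).+1 by rewrite subnSK.
  apply: ideal_mul_min => [|a u ha hu]; first exact: ideal_mul_ideal.
  rewrite mulrC; apply: (ideal_mul_min (colon_ideal u (ideal_mul_ideal _ _)) _ ha) => x y Ix hy.
  have -> : colon (ideal_mul (ideal_exp I (n - j.+1)) (L j.+1)) u (x * y) =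
    ideal_mul (ideal_exp I (n - j.+1)) (L j.+1) (y * (x * u)).
    by rewrite /colon /=; congr (ideal_mul _ _ _); ring.
  by apply: mem_ideal_mul => //; case: (hL j) => _ _; apply.
exists r; case=> [|p] u hu.
  by rewrite -(mul1r u); apply: mem_ideal_mul => //; rewrite -[r]addn0.
rewrite -FL; apply: (hr (r + p.+1)%N); rewrite /F leqnn //.
Qed.

End Rees.

(** * Generic elements *)

Section GenericElement.
Variable A : comNzRingType.
Variables (S H : set A) (t : nat -> A).
Hypotheses (sS : subring S) (sH : submod S H).
Hypotheses (St : forall j, S (t j))
  (t_unit : forall i j, i != j -> exists2 v, S v & v * (t i - t j) = 1).
Implicit Types (u a : A) (p q : {poly A}).

(* Newton interpolation: dividing p - p(t_j) by 'X - t_j, one node at a time. *)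
Lemma coef_interpolation p (js : seq nat) : uniq js -> (size p <= size js)%N ->
  (forall j, j \in js -> H p.[t j]) -> forall i, H p`_i.
Proof.
have H0 : H 0 by case: sH.
elim: js p => [|j js IH] p /=.
  by move=> _; rewrite leqn0 size_poly_eq0 => /eqP-> _ i; rewrite coef0.
move=> /andP[jjs ujs] sp hp.
have hc := hp j (mem_head _ _); set c := p.[t j] in hc.
have /factor_theorem[q eq] : root (p - c%:P) (t j).
  by rewrite /root hornerD hornerN hornerC subrr.
have ep : p = q * ('X - (t j)%:P) + c%:P by rewrite -eq subrK.
have sq : (size q <= size js)%N.
  have [->|q0] := eqVneq q 0; first by rewrite size_poly0.
  have sq1 : size (p - c%:P) = (size q).+1.
    by rewrite eq size_Mmonic ?monicXsubC // size_XsubC addn2.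
  have : (size (p - c%:P)%R <= maxn (size p) 1)%N.
    apply: leq_trans (size_polyD _ _) _; rewrite size_polyN geq_max leq_maxl /=.
    by apply: leq_trans (size_polyC_leq1 _) (leq_maxr _ _).
  have : (0 < size q)%N by rewrite size_poly_gt0.
  rewrite sq1 leq_max => q_gt0 /orP[h|]; first exact: leq_trans h sp.
  by rewrite ltnS leqNgt q_gt0.
have qH : forall i, H q`_i.
  apply: IH => // l ljs; have lj : l != j by apply: contraNneq jjs => <-.
  have [v Sv ev] := t_unit lj.
  have -> : q.[t l] = v * (p.[t l] - c).
    by rewrite {1}ep hornerD hornerC addrK hornerM hornerXsubC mulrCA ev mulr1.
  apply: submodM sH Sv _; apply: (submodB sS sH) => //; apply: hp; rewrite inE ljs orbT //.
move=> i; rewrite ep coefD coefC mulrBr coefB coefMX coefMC.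
apply: (submodD sS sH); last by case: ifP.
apply: (submodB sS sH); first by case: ifP.
by rewrite mulrC; exact: submodM sH _ _.
Qed.

Variable c : seq A.
Hypotheses (nS : noeth_sub S) (Sc : forall x, x \in c -> S x)
  (c_reg : forall u, S u -> (forall x, x \in c -> H (x * u)) -> H u).

Definition moment j : A := \sum_(i < size c) t j ^+ i * c`_i.

Lemma moment_sub j : S (moment j).
Proof.
apply: subring_sum => // i _; apply: subringM => //; first exact: subringX.
by apply: Sc; exact: mem_nth.
Qed.

(** The polynomial \sum_i c_i u X^i takes the value [moment j * u] at t_j, so interpolation at
    [size c] nodes puts each of its coefficients c_i u in H. *)
Lemma moment_few u (js : seq nat) : S u -> uniq js -> (forall j, j \in js -> H (moment j * u)) ->
  (size c <= size js)%N -> H u.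
Proof.
move=> Su ujs hjs sc; apply: c_reg => // x xc.
pose p := \poly_(i < size c) (c`_i * u).
have hp : forall i, H p`_i.
  apply: (coef_interpolation ujs); first exact: leq_trans (size_poly _ _) sc.
  move=> j /hjs; rewrite horner_poly /moment big_distrl /=.
  by rewrite (eq_bigr (fun i : 'I__ => c`_i * u * t j ^+ i)) // => i _; ring.
have := hp (index x c); rewrite coef_poly index_mem xc nth_index //.
Qed.

(** The triple is (u, l, s): u lies outside H, l is a list of indices whose moments carry u into H,
    and s >= n belongs to l. By [moment_few] the size of l is bounded, so it can be taken maximal;
    then no moment with index outside l carries a multiple of u into H unless that multiple is
    already in H. *)
Lemma critical_element : (forall n, exists2 j, (n <= j)%N & exists u,
    [/\ S u, ~ H u & H (moment j * u)]) ->
  forall n, exists w : A * seq nat * nat, [/\ S w.1.1, ~ H w.1.1, (n <= w.2)%N,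
    w.2 \in w.1.2 /\ (forall j, j \in w.1.2 -> H (moment j * w.1.1)) &
    forall a j, S a -> j \notin w.1.2 -> H (moment j * (a * w.1.1)) -> H (a * w.1.1)].
Proof.
move=> bad n.
pose Q k := exists u (l : seq nat) s, [/\ S u, ~ H u, (n <= s)%N /\ s \in l,
  uniq l /\ size l = k & forall j, j \in l -> H (moment j * u)].
case: (@bounded_max Q (size c)).
- have [j nj [u [Su Hu hu]]] := bad n; exists 1%N, u, [:: j], j.
  by split=> //; [rewrite mem_head|move=> i; rewrite inE => /eqP->].
- move=> k [u [l [s [Su Hu _ [ul <-] hl]]]]; apply: contrapT => /negP; rewrite -ltnNge => h.
  by apply: Hu; apply: (moment_few Su ul hl); exact: ltnW.
move=> k [[u [l [s [Su Hu [ns sl] [ul sz] hl]]]] kmax].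
exists ((u, l), s); split=> //= a j Sa jl hj; apply: contrapT => Hau.
have : Q k.+1.
  exists (a * u), (j :: l), s; split=> //; first exact: subringM.
  - by rewrite inE sl orbT.
  - by rewrite /= jl ul sz.
  - move=> i; rewrite inE => /orP[/eqP-> //|/hl h].
    by rewrite mulrCA; exact: submodM sH _ _.
by move=> /kmax; rewrite ltnn.
Qed.

(* If infinitely many moment elements were zero divisors modulo H, critical
   elements for larger and larger indices would span an infinite direct sum. *)
Theorem moment_regular : exists n0, forall j, (n0 <= j)%N ->
  forall u, S u -> H (moment j * u) -> H u.
Proof.
apply: contrapT => nreg.
have bad n : exists2 j, (n <= j)%N & exists u, [/\ S u, ~ H u & H (moment j * u)].
  apply: contrapT => h; apply: nreg; exists n => j nj u Su hu; apply: contrapT => Hu.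
  by apply: h; exists j => //; exists u.
have [w hw] := choice (critical_element bad).
(* The next threshold exceeds every index of the current list, so s_j is outside l_i for i < j. *)
pose next n := maxn n (\max_(j <- (w n).1.2) j.+1)%N.
pose N i := iter i next 0%N.
have N_le i j : (i <= j)%N -> (N i <= N j)%N.
  move=> /subnKC <-; elim: (j - i)%N => [|p IH]; first by rewrite addn0.
  by rewrite addnS /=; apply: leq_trans IH _; exact: leq_maxl.
pose u i := (w (N i)).1.1; pose l i := (w (N i)).1.2; pose s i := (w (N i)).2.
have Su i : S (u i) by case: (hw (N i)).
have s_l i j : (i < j)%N -> s j \notin l i.
  move=> ij; apply/negP => h.
  have h1 : (N j <= s j)%N by case: (hw (N j)).
  have h2 : ((s j).+1 <= next (N i))%N.
    apply: leq_trans (leq_maxr _ _).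
    exact: (@leq_bigmax_seq _ (l i) xpredT (fun j => j.+1)).
  have h3 := N_le _ _ ij; rewrite /= in h3.
  by have := leq_trans h2 (leq_trans h3 h1); rewrite ltnn.
(* Multiplying a relation by the moment of index s_n kills the term of u_n modulo H, while for i < n
   criticality of u_i allows this moment to be cancelled again. *)
have indep_u n (a : nat -> A) : (forall i, S (a i)) -> H (\sum_(i < n) a i * u i) ->
    forall i, (i < n)%N -> H (a i * u i).
  elim: n a => [//|n IH] a Sa; rewrite big_ord_recr /= => hsum.
  have hn : forall i, (i < n)%N -> H (a i * u i).
    move=> i lin; case: (hw (N i)) => _ _ _ _ crit.
    apply: (crit (a i) (s n)) => //; first exact: s_l.
    have Sm j : S (moment (s n) * a j) by apply: subringM => //; exact: moment_sub.
    have := IH (fun j => moment (s n) * a j) Sm _ i lin; rewrite -mulrA; apply.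
    have -> : \sum_(j < n) moment (s n) * a j * u j =
        moment (s n) * (\sum_(j < n) a j * u j + a n * u n) - a n * (moment (s n) * u n).
      rewrite mulrDr big_distrr /= [X in _ + X - _]mulrCA addrK; apply: eq_bigr => j _.
      by rewrite mulrA.
    apply: (submodB sS sH); first by apply: submodM sH _ hsum; exact: moment_sub.
    apply: submodM sH _ _ => //; case: (hw (N n)) => _ _ _ [sl hl] _; exact: hl.
  move=> i; rewrite ltnS leq_eqVlt => /orP[/eqP->|]; last exact: hn.
  rewrite -(addKr (\sum_(j < n) a j * u j) (a n * u n)); apply: (submodD sS sH) => //.
  apply: (submodN sS sH); apply: submod_sum sS sH _ => j _; exact: hn.
(* The chain H + (u_0, ..., u_(n-1)) must become stationary, which expresses some u_n by earlier
   ones and contradicts the direct sum. *)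
pose M n : set A := [set x | exists (h : A) (a : nat -> A), [/\ H h, (forall i, S (a i)) &
  x = h + \sum_(i < n) a i * u i]].
have HS : H `<=` S by case: sH.
case: (nS (N := M)) => [n|n x [h [a [Hh Sa ->]]]|n /(_ n.+1)].
- split=> [_ [h [a [Hh Sa ->]]]||b _ _ Sb [h [a [Hh Sa ->]]] [h' [a' [Hh' Sa' ->]]]].
  + apply: subringD => //; [exact: HS|apply: subring_sum => // i _; exact: subringM].
  + exists 0, (fun=> 0); split=> [|_|]; [by case: sH|exact: subring0|].
    by rewrite big1 ?addr0 // => i _; rewrite mul0r.
  + exists (b * h + h'), (fun i => b * a i + a' i); split.
    * by apply: (submodD sS sH) => //; exact: submodM sH _ _.
    * by move=> i; apply: subringD => //; exact: subringM.
    * rewrite mulrDr -addrACA big_distrr -big_split /=; congr (_ + _).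
      by apply: eq_bigr => i _; ring.
- exists h, (fun i => if (i < n)%N then a i else 0); split=> // [i|].
    by case: ifP => // _; exact: subring0.
  rewrite big_ord_recr /= ltnn mul0r addr0; congr (_ + _).
  by apply: eq_bigr => i _; rewrite ltn_ord.
have S1 : S 1 by case: sS.
move=> /(_ (u n)) [|h [a [Hh Sa e]]].
  exists 0, (fun i => (i == n)%:R); split=> [|i|]; first by case: sH.
    by case: eqP => // _; exact: subring0.
  rewrite big_ord_recr /= eqxx mul1r big1 ?add0r // => i _.
  by rewrite ltn_eqF ?mul0r // ltn_ord.
case: (hw (N n)) => _ Hu _ _ _; apply: Hu; rewrite -/(u n).
have := indep_u n.+1 (fun i => if (i < n)%N then - a i else 1) _ _ n (ltnSn n).
rewrite ltnn mul1r; apply.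
  by move=> i; case: ifP => // _; exact: subringN.
rewrite big_ord_recr /= ltnn mul1r.
rewrite (eq_bigr (fun i : 'I_n => - (a i * u i))) => [|i _]; last by rewrite ltn_ord mulNr.
by rewrite sumrN e addrC addrK.
Qed.

End GenericElement.

(** * Superficial elements *)

Lemma uniform_bound (T : eqType) (s : seq T) (P : T -> nat -> Prop) :
  (forall x i j, (i <= j)%N -> P x i -> P x j) ->
  (forall x, x \in s -> exists i, P x i) -> exists i, forall x, x \in s -> P x i.
Proof.
move=> mono; elim: s => [|y s IH] h; first by exists 0%N.
case: IH => [x xs|i hi]; first by apply: h; rewrite inE xs orbT.
have [j hj] := h y (mem_head _ _).
exists (maxn i j) => x; rewrite inE => /orP[/eqP->|/hi].
  exact: mono (leq_maxr _ _) hj.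
exact: mono (leq_maxl _ _).
Qed.

Section Superficial.
Variables (R : comNzRingType) (m I : set R) (t : nat -> R) (c : seq R).
Hypotheses (R_noeth : noetherian R) (R_local : local_ring m).
Hypotheses (t_diff : forall i j, i != j -> ~ m (t i - t j)).
Hypotheses (iI : ideal I) (I_rad : forall a, m a -> exists n, I (a ^+ n))
  (I_gen : I = ideal_gen [set` c]).
Implicit Types (J : set R) (a u x y : R).

Let x := moment t c.

Lemma gen_in y : y \in c -> I y.
Proof. by move=> yc; rewrite I_gen; exact: sub_ideal_gen. Qed.

Lemma moment_in j : I (x j).
Proof.
by apply: ideal_sum => // i _; apply: idealZl => //; apply: gen_in; exact: mem_nth.
Qed.

Lemma colon_gen K u : ideal K -> (forall y, y \in c -> K (y * u)) ->
  forall y, I y -> K (y * u).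
Proof.
move=> iK h y; rewrite I_gen mulrC => hy.
by apply: (ideal_gen_min (colon_ideal u iK) _ hy) => z /h; rewrite /colon /= mulrC.
Qed.

Lemma t_unit_setT i j : i != j -> exists2 v, (setT : set R) v & v * (t i - t j) = 1.
Proof.
move=> /t_diff /(notin_max_unit R_noeth R_local)[v ev]; exists v => //.
by rewrite mulrC.
Qed.

Lemma noeth_setT : noeth_sub (setT : set R).
Proof.
move=> N sN incN; apply: ideal_acc => // i; have [_ h0 h] := sN i.
by split=> // b y z; exact: h.
Qed.

(** A power of a lies in I, so an element carried into J by all generators of I is carried into J by
    that power and hence lies in J. *)
Lemma moment_nzd J a : ideal J -> m a -> nzd J a ->
  exists n0, forall j, (n0 <= j)%N -> nzd J (x j).
Proof.
move=> iJ ma aJ.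
have [|||||n0 hn0] := @moment_regular R setT J t _ _ _ t_unit_setT c noeth_setT.
- by split=> //; split.
- by split=> //; [case: iJ|move=> b y z _; case: iJ => _; apply].
- by [].
- by [].
- move=> u _ hu; have [n an] := I_rad ma; apply: (@nzdX _ J a n aJ).
  exact: (colon_gen iJ hu).
exists n0 => j nj u; exact: hn0.
Qed.

Lemma add_exp_ideal J n : ideal J -> ideal (ideal_add (ideal_exp I n) J).
Proof. by move=> iJ; apply: ideal_add_ideal => //; exact: ideal_exp_ideal. Qed.

Lemma add_expM J i n a u : ideal J -> ideal_exp I i a ->
  ideal_add (ideal_exp I n) J u -> ideal_add (ideal_exp I (i + n)) J (a * u).
Proof.
move=> iJ ha [v hv [w hw ->]]; exists (a * v); first exact: mem_ideal_expD.
by exists (a * w); [exact: idealZl|rewrite mulrDr].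
Qed.

(* Lifts to I^n of the elements of degree n of gr_I(R/J) that are killed by the
   s-th power of the irrelevant ideal. *)
Definition torsion J s n : set R := [set u | ideal_exp I n u /\
  forall a, ideal_exp I s a -> ideal_add (ideal_exp I (n + s).+1) J (a * u)].

(** All exponents together: the zeroth local cohomology of gr_I(R/J) in degree n, lifted to R. *)
Definition torsion_family J n : set R := [set u | exists s, torsion J s n u].

Lemma torsion_le J s s' n : ideal J -> (s <= s')%N -> torsion J s n `<=` torsion J s' n.
Proof.
move=> iJ ss u [hu h]; split=> // a; rewrite -(subnK ss) mulrC => ha.
have iK := colon_ideal u (add_exp_ideal (n + (s' - s + s)).+1 iJ).
apply: (ideal_exp_min iK _ ha) => b d hb hd.
have -> : (n + (s' - s + s)).+1 = (s' - s + (n + s).+1)%N by lia.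
by rewrite /colon /= mulrC -mulrA; apply: add_expM => //; exact: h.
Qed.

Lemma torsion_rees J : ideal J -> rees_family I (torsion_family J).
Proof.
move=> iJ n; split=> [|u [s []] //|a u Ia [s [hu h]]].
  split=> [|b u v [s hs] [s' hs']].
    exists 0%N; split; first exact: ideal0 (ideal_exp_ideal _ _).
    by move=> b _; rewrite mulr0; exact: ideal0 (add_exp_ideal _ _).
  have [hu h] := torsion_le iJ (leq_maxl s s') hs.
  have [hv h'] := torsion_le iJ (leq_maxr s s') hs'.
  have iE := ideal_exp_ideal I n.
  exists (maxn s s'); split; first exact: idealD iE (idealZl b iE hu) hv.
  move=> d hd; rewrite mulrDr mulrCA; have iK := add_exp_ideal (n + maxn s s').+1 iJ.
  by apply: (idealD iK); [apply: (idealZl b iK)|]; [exact: h|exact: h'].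
exists s; split; first exact: mem_ideal_mul.
move=> b /h hb; rewrite mulrCA !addSn -add1n; apply: add_expM => //.
exact: mem_ideal_exp1.
Qed.

(** The torsion of gr_I(R/J) vanishes in high degrees. From degree r on, the family T is generated
    by T_r, and one exponent s serves all of T_r; hence T_(r+s+p) lies in I^p I^s T_r, which is
    inside I^(r+s+p+1) + J. *)
Lemma torsion_sub J : ideal J -> exists n1, forall n, (n1 <= n)%N ->
  torsion_family J n `<=` ideal_add (ideal_exp I n.+1) J.
Proof.
move=> iJ; have hT := torsion_rees iJ; have [r hr] := family_gen R_noeth iI hT.
have [iTr _ _] := hT r; have [g eg] := R_noeth iTr.
have [s hs] : exists s, forall u, torsion_family J r u -> torsion J s r u.
  have [|u ug|s hs] := @uniform_bound _ g (fun u s => torsion J s r u).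
  - by move=> u i j ij; exact: torsion_le.
  - by have : torsion_family J r u by rewrite eg; exact: sub_ideal_gen.
  exists s => u; rewrite eg; apply: ideal_gen_min => //.
  split=> [|b y z [hy h] [hz h']].
    split; first exact: ideal0 (ideal_exp_ideal _ _).
    by move=> b _; rewrite mulr0; exact: ideal0 (add_exp_ideal _ _).
  split; first exact: idealD (ideal_exp_ideal I r) (idealZl b (ideal_exp_ideal I r) hy) hz.
  move=> d hd; rewrite mulrDr mulrCA; have iK := add_exp_ideal (r + s).+1 iJ.
  by apply: (idealD iK); [apply: (idealZl b iK)|]; [exact: h|exact: h'].
exists (r + s)%N => n; move=> /subnKC <-; set p := (n - (r + s))%N.
rewrite -addnA; apply: subset_trans (hr _) _.
have iK := add_exp_ideal (r + (s + p)).+1 iJ.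
apply: (ideal_mul_min iK) => b u hb /hs[hu h].
rewrite addnC in hb; rewrite mulrC; apply: (ideal_exp_min (colon_ideal u iK) _ hb) => y z hy hz.
have -> : (r + (s + p)).+1 = (p + (r + s).+1)%N by lia.
by rewrite /colon /= mulrC -mulrA; apply: add_expM => //; exact: h.
Qed.

(** The generic element theorem is applied in the Rees algebra to the degree one elements c_i X,
    whose moments are x_j X. If every c_i X f is torsion, so is f, with an exponent larger by
    one. *)
Lemma moment_torsion J : ideal J -> exists n0, forall j, (n0 <= j)%N ->
  forall n u, ideal_exp I n u -> torsion_family J n.+1 (x j * u) -> torsion_family J n u.
Proof.
move=> iJ; have hT := torsion_rees iJ.
pose c' := map (fun y => y *: 'X) c; pose t' j := (t j)%:P : {poly R}.
have coefTf y (f : {poly R}) n : ((y *: 'X) * f)`_n.+1 = y * f`_n.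
  by rewrite -scalerAl coefZ coefXM.
have reesC b : rees I b%:P.
  by case=> [//|n]; rewrite coefC; exact: ideal0 (ideal_exp_ideal _ _).
have [|||i j ij|y /mapP[z zc ->] n|f hf hfc|n0 hn0] :=
  @moment_regular _ (rees I) (family_set (torsion_family J)) t'
   _ _ _ _ c' (rees_noeth R_noeth iI).
- exact: rees_subring.
- exact: family_submod.
- by move=> j; exact: reesC.
- have [v _ ev] := t_unit_setT ij; exists v%:P; first exact: reesC.
  by rewrite -polyCB -polyCM ev.
- rewrite coefZ coefX; case: eqP => [->|_]; last first.
    by rewrite mulr0; exact: ideal0 (ideal_exp_ideal _ _).
  by rewrite mulr1; apply: mem_ideal_exp1; exact: gen_in.
- move=> n.
  have [|y yc|s hs] := @uniform_bound _ c (fun y s => torsion J s n.+1 (y * f`_n)).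
  + by move=> y i j ij; exact: torsion_le.
  + have := hfc (y *: 'X) _ n.+1; rewrite coefTf; apply.
    by apply/mapP; exists y.
  exists s.+1; split; first exact: hf.
  have iK := add_exp_ideal (n + s.+1).+1 iJ.
  move=> b hb; rewrite mulrC; apply: (ideal_mul_min (colon_ideal f`_n iK) _ hb) => y a Iy ha.
  rewrite /colon /= mulrC -mulrA; apply: (colon_gen iK _ Iy) => z zc.
  by rewrite mulrCA addnS -addSn; apply: (hs z zc).2.
exists n0 => j nj n u hu hxu.
have hm : moment t' c' j = x j *: 'X.
  rewrite /moment size_map scaler_suml; apply: eq_bigr => i _.
  by rewrite (nth_map 0) // -polyC_exp mul_polyC scalerA.
have := hn0 j nj (u *: 'X^n) _ _ n; rewrite coefZ coefXn eqxx mulr1; apply.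
  move=> i; rewrite coefZ coefXn; case: eqP => [->|_]; first by rewrite mulr1.
  by rewrite mulr0; exact: ideal0 (ideal_exp_ideal _ _).
rewrite hm; case=> [|i].
  by rewrite -scalerAl coefZ coefXM mulr0; apply: ideal0; case: (hT 0%N).
rewrite coefTf coefZ coefXn; case: eqP => [->|_]; first by rewrite mulr1.
by rewrite !mulr0; apply: ideal0; case: (hT i.+1).
Qed.

(* Artin-Rees for J + yR. *)
Lemma colon_exp_sub J y : ideal J -> nzd J y -> exists r, forall p,
  colon (ideal_add (ideal_exp I (r + p)) J) y `<=` ideal_add (ideal_exp I p) J.
Proof.
move=> iJ hy; have iJy := addx_ideal y iJ.
(* Generation of this family from degree r puts its component of degree r + p inside J + y I^p; then
   y cancels modulo J. *)
have hM : rees_family I (fun n => ideal_exp I n `&` addx J y).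
  move=> n; have iE := ideal_exp_ideal I n; split=> [|u [] //|a u Ia [h1 h2]].
    split=> [|b u v [h1 h2] [h3 h4]]; first by split; [exact: ideal0 iE|exact: ideal0 iJy].
    by split; [exact: idealD iE (idealZl b iE h1) h3|exact: idealD iJy (idealZl b iJy h2) h4].
  by split; [exact: mem_ideal_mul|exact: idealZl].
have [r hr] := family_gen R_noeth iI hM; exists r => p u.
move=> [v hv [w Jw e]].
have : ideal_add J (scale y (ideal_exp I p)) v.
  have iK : ideal (ideal_add J (scale y (ideal_exp I p))).
    by apply: ideal_add_ideal => //; apply: scale_ideal; exact: ideal_exp_ideal.
  apply: (ideal_mul_min iK) (hr p v _); last first.
    split=> //; apply/addxP; exists (- w); first exact: idealN.
    by exists u; rewrite e addrC addrK.
  move=> a b ha [_ /addxP[j Jj [z ->]]]; exists (a * j); first exact: idealZl.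
  exists (y * (a * z)); last by ring.
  exists (a * z) => //; exact (idealZr z (ideal_exp_ideal I p) ha).
move=> [j Jj [_ [a ha <-] ev]]; exists a => //; exists (u - a); last by rewrite addrC subrK.
apply: hy; have -> : y * (u - a) = j + w by rewrite mulrBr e ev; ring.
exact: idealD.
Qed.

(** If x u lies in I^(n+1) + J, then [colon_exp_sub] brings u into I^n1 + J, beyond all torsion.
    From there u climbs one degree at a time: its class in degree p < n is killed by x, hence
    torsion, hence zero. *)
Lemma moment_superficial J : ideal J -> exists n0, forall j, (n0 <= j)%N -> nzd J (x j) ->
  exists N, forall n, (N <= n)%N ->
    colon (ideal_add (ideal_exp I n.+1) J) (x j) = ideal_add (ideal_exp I n) J.
Proof.
move=> iJ; have [n0 hn0] := moment_torsion iJ; have [n1 hn1] := torsion_sub iJ.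
exists n0 => j nj xj_nzd; have [r hr] := colon_exp_sub iJ xj_nzd.
have monoE p q : (p <= q)%N -> ideal_add (ideal_exp I q) J `<=` ideal_add (ideal_exp I p) J.
  by move=> pq; apply: ideal_addS => //; exact: ideal_exp_le.
exists (r + n1)%N => n le_n; apply/seteqP; split=> u; last first.
  by move=> hu; rewrite -add1n; apply: add_expM => //; apply: mem_ideal_exp1; exact: moment_in.
move=> hu; have h p : (n1 <= p)%N -> (p <= n)%N -> ideal_add (ideal_exp I p) J u.
  elim: p => [|p IH] n1p pn; first by exists u => //; exists 0; [exact: ideal0|rewrite addr0].
  have [n1p'|pn1] := leqP n1 p; last first.
    have -> : p.+1 = n1 by apply/eqP; rewrite eqn_leq pn1 n1p.
    by apply: hr; apply: monoE hu; exact: leqW.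
  have [v hv [w Jw e]] := IH n1p' (ltnW pn).
  rewrite e; apply: idealD; first exact: add_exp_ideal; last first.
    exact: ideal_add_subr (ideal_exp_ideal _ _) _ Jw.
  (* Exponent 0 suffices, because x v already lies in I^(p+2) + J. *)
  apply: (hn1 _ n1p'); apply: (hn0 _ nj _ _ hv); exists 0%N; split.
    by apply: mem_ideal_mul; [exact: moment_in|exact: hv].
  move=> b _; rewrite addn0; have iK := add_exp_ideal p.+2 iJ; apply: (idealZl b iK).
  have -> : v = u - w by rewrite e addrK.
  rewrite mulrBr; apply: (idealB iK); first by apply: monoE hu.
  by apply: (ideal_add_subr (ideal_exp_ideal _ _)); exact: idealZl.
by apply: h => //; apply: leq_trans le_n; exact: leq_addl.
Qed.

End Superficial.

(** * The Eakin-Sathaye theorem *)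

Section EakinSathaye.
Variables (R : comNzRingType) (m : set R) (t : nat -> R).
Hypotheses (R_noeth : noetherian R) (R_local : local_ring m).
Hypotheses (t_diff : forall i j, i != j -> ~ m (t i - t j)).
Implicit Types (I J K A W : set R) (a u y z : R).

(** An independent extension of maximal size spans: if a new vector a cannot be appended, some
    relation has a unit as coefficient of a. *)
Lemma indep_basis K A q v : ideal K -> ideal A -> ideal_mul m A `<=` K -> K `<=` A ->
  finlen K A -> (forall i, (i < q)%N -> A (v i)) -> indep m K q v ->
  exists r (b : nat -> R), [/\ forall i, (i < q)%N -> b i = v i, indep m K (q + r) b &
    forall a, A a -> exists c : nat -> R, K (a - \sum_(j < q + r) c j * b j)].
Proof.
move=> iK iA mA KA fl Av hv.
pose P r := exists b : nat -> R, [/\ forall i, (i < q)%N -> b i = v i,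
  forall i, (i < q + r)%N -> A (b i) & indep m K (q + r) b].
case: (@bounded_max P (len K A)).
- by exists 0%N, v; rewrite addn0.
- move=> r [b [_ Ab hb]].
  exact: leq_trans (leq_addl q r) (indep_len R_local iK iA KA fl Ab hb).
move=> r [[b [bv Ab hb]] rmax]; exists r, b; split=> // a Aa.
pose b' i := if (i < q + r)%N then b i else a.
have sumb' (c : nat -> R) : \sum_(i < (q + r).+1) c i * b' i =
    \sum_(i < q + r) c i * b i + c (q + r)%N * a.
  rewrite big_ord_recr /= {2}/b' ltnn; congr (_ + _); apply: eq_bigr => i _.
  by rewrite /b' ltn_ord.
have : ~ indep m K (q + r).+1 b'.
  move=> h; have : P r.+1; last by move=> /rmax; rewrite ltnn.
  exists b'; split=> [i iq|i|]; last by rewrite addnS.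
    by rewrite /b' (leq_trans iq (leq_addr _ _)) bv.
  by rewrite /b'; case: ifP => // ir _; exact: Ab.
move=> nindep; apply: contrapT => nex; apply: nindep => c; rewrite sumb' => hc.
have mc : m (c (q + r)%N).
  apply: contrapT => /(notin_max_unit R_noeth R_local)[e ee]; apply: nex.
  exists (fun j => - (e * c j)).
  have -> : a - \sum_(j < q + r) - (e * c j) * b j =
      e * (\sum_(j < q + r) c j * b j + c (q + r)%N * a).
    rewrite mulrDr mulrA (mulrC e (c _)) ee mul1r addrC big_distrr /= -sumrN; congr (_ + _).
    by apply: eq_bigr => j _; ring.
  exact: idealZl.
move=> i; rewrite ltnS leq_eqVlt => /orP[/eqP-> //|]; apply: hb.
by apply: ideal_addr hc => //; apply: mA; exact: mem_ideal_mul.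
Qed.

(* The determinant of the perturbed family is a polynomial in s with value 1 at s = 0. *)
Lemma indep_perturb K A q v w : ideal K -> ideal A -> ideal_mul m A `<=` K -> K `<=` A ->
  finlen K A -> (forall i, (i < q)%N -> A (v i)) -> (forall i, (i < q)%N -> A (w i)) ->
  indep m K q v -> exists2 s, ~ m s & indep m K q (fun i => v i + s * w i).
Proof.
move=> iK iA mA KA fl Av Aw hv.
have im := max_ideal R_local.
have [r [b [bv hb span]]] := indep_basis iK iA mA KA fl Av hv.
have : forall i, exists c : nat -> R, (i < q)%N -> K (w i - \sum_(j < q + r) c j * b j).
  move=> i; have [iq|] := ltnP i q; last by exists (fun=> 0).
  by have [c hc] := span _ (Aw i iq); exists c.
move=> /choice[g hg]; pose W : 'M[R]_q := \matrix_(i, j) g i j.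
pose p : {poly R} := \det (1%:M + 'X *: map_mx polyC W).
have pE s : p.[s] = \det (1%:M + s *: W).
  rewrite -horner_evalE /p -det_map_mx; congr (\det _); apply/matrixP => i j.
  by rewrite !mxE /= horner_evalE hornerD hornerM hornerX !hornerC hornerMn hornerC.
(* The factor 'X makes s = t_j a unit as well. The coefficient of 'X in this product is p(0) = 1, so
   by interpolation its values cannot all lie in m. *)
have [j hj] : exists j, ~ m (p * 'X).[t j].
  apply: contrapT => nex; apply: (max_proper R_local).
  have -> : 1 = (p * 'X)`_1 by rewrite coefMX /= -horner_coef0 pE scale0r addr0 det1.
  apply: (@coef_interpolation R setT m t _ _ _ _ _ (iota 0 (size (p * 'X)%R))).
  - by split=> //; split.
  - by split=> //; [exact: ideal0|move=> a x y _; case: im => _; apply].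
  - by [].
  - exact: (t_unit_setT R_noeth R_local t_diff).
  - exact: iota_uniq.
  - by rewrite size_iota.
  - by move=> j _; apply: contrapT => hj; apply: nex; exists j.
have nms : ~ m (t j) by move=> ms; apply: hj; rewrite hornerMX; exact: idealZl.
have nmd : ~ m (p.[t j]) by move=> ms; apply: hj; rewrite hornerMX; exact: idealZr.
exists (t j) => // c; set s := t j in nms nmd * => hc.
(* Coordinates, modulo K, of \sum_i c_i (v_i + s w_i) in the basis b. The first q of them form the
   row c (1 + s W), from which the adjugate recovers c. *)
pose d k := (if (k < q)%N then c k else 0) + s * \sum_(i < q) c i * g i k.
have md k : (k < q + r)%N -> m (d k).
  apply: hb; have -> : \sum_(k < q + r) d k * b k = \sum_(i < q) c i * (v i + s * w i) -
      \sum_(i < q) c i * s * (w i - \sum_(k < q + r) g i k * b k).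
    rewrite -sumrB.
    have -> : \sum_(k < q + r) d k * b k = \sum_(k < q + r) (if (k < q)%N then c k else 0) * b k
        + \sum_(i < q) c i * s * (\sum_(k < q + r) g i k * b k).
      under [X in _ = _ + X]eq_bigr => i _ do rewrite big_distrr /=.
      rewrite exchange_big -big_split; apply: eq_bigr => l _ /=.
      rewrite /d mulrDl big_distrr big_distrl; congr (_ + _); apply: eq_bigr => i _ /=; ring.
    rewrite big_split_ord /= [X in _ + X + _]big1 => [|l _]; last by rewrite ltnNge leq_addr mul0r.
    rewrite addr0 -big_split; apply: eq_bigr => i _ /=; rewrite ltn_ord bv //; ring.
  apply: idealB => //; apply: ideal_sum => // i _; apply: idealZl => //; exact: hg.
move=> i iq; apply: max_prime nmd => //.
pose M := 1%:M + s *: W; pose cc : 'rV[R]_q := \row_k c k.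
have -> : p.[s] * c i = ((cc *m M) *m \adj M) 0 (Ordinal iq).
  by rewrite -mulmxA mul_mx_adj mul_mx_scalar !mxE pE.
rewrite mxE; apply: ideal_sum => // k _; apply: idealZr => //.
have -> : (cc *m M) 0 k = d k.
  rewrite mulmxDr mulmx1 -scalemxAr !mxE /d ltn_ord; congr (_ + _ * _).
  by apply: eq_bigr => l _; rewrite !mxE.
by apply: md; exact: ltn_addr.
Qed.

(** In a pencil b0 + s b1 of maps from W to A / K, a member b0 of maximal rank has its kernel sent
    by b1 into its own image. Otherwise b1 w extends a basis b0 f_i of the image, and for a suitable
    unit s the vectors (b0 + s b1) f_i and (b0 + s b1) w = s b1 w would give rank q + 1. *)
Lemma max_rank_kernel K A W (b0 b1 w : R) : ideal K -> ideal A -> ideal W ->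
  ideal_mul m A `<=` K -> K `<=` A -> finlen K A ->
  (forall u, W u -> A (b0 * u)) -> (forall u, W u -> A (b1 * u)) ->
  (forall s, (len K (ideal_add K (scale (b0 + s * b1) W)) <=
    len K (ideal_add K (scale b0 W)))%N) ->
  W w -> K (b0 * w) -> ideal_add K (scale b0 W) (b1 * w).
Proof.
move=> iK iA iW mA KA fl A0 A1 hmax Ww Kw; apply: contrapT => nb1.
have iU b : ideal (ideal_add K (scale b W)) by apply: ideal_add_ideal => //; exact: scale_ideal.
have KU b : K `<=` ideal_add K (scale b W) by apply: ideal_add_subl; exact: scale_ideal.
have UA b : (forall u, W u -> A (b * u)) -> ideal_add K (scale b W) `<=` A.
  by move=> h; apply: ideal_add_min => //; exact: scale_min.
have mU : ideal_mul m (ideal_add K (scale b0 W)) `<=` K.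
  by apply: subset_trans mA; apply: ideal_mulSr; exact: UA.
have flU b : (forall u, W u -> A (b * u)) -> finlen K (ideal_add K (scale b W)).
  by move=> h; apply: finlen_sub fl => //; exact: UA.
have [v [Uv hv]] := indep_ex R_noeth R_local iK (iU b0) mU (KU b0) (flU b0 A0).
set q := len K _ in Uv hv hmax.
have : forall i, exists u, (i < q)%N -> W u /\ K (v i - b0 * u).
  move=> i; have [iq|] := ltnP i q; last by exists 0.
  have [k Kk [_ [u Wu <-] ->]] := Uv i iq; exists u => _; split=> //.
  by rewrite addrK.
move=> /choice[f hf].
have hf' : indep m K q (fun i => b0 * f i).
  by apply: (indep_mod iK _ hv) => i iq; exact: (hf i iq).2.
(* The last vector gets the perturbation 0: it needs only the factor s to lie in the image of b0 + s
   b1. *)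
pose V i := if (i < q)%N then b0 * f i else b1 * w.
pose V' i := if (i < q)%N then b1 * f i else 0.
have AV i : A (V i) by rewrite /V; case: ifP => [/hf[Wf _]|_]; [exact: A0|exact: A1].
have hV : indep m K q.+1 V.
  move=> c; rewrite big_ord_recr /= {2}/V ltnn.
  rewrite (eq_bigr (fun i : 'I_q => c i * (b0 * f i))) => [hc|i _]; last by rewrite /V ltn_ord.
  have mc : m (c q).
    apply: contrapT => nm; apply: nb1; apply: (ideal_cancel_unit R_noeth R_local (iU b0) nm).
    move/(KU b0): hc; rewrite addrC; apply: ideal_addr => //.
    apply: ideal_sum => // i _; apply: idealZl => //.
    by apply: (ideal_add_subr iK); apply: mem_scale; exact: (hf i (ltn_ord i)).1.
  move=> i; rewrite ltnS leq_eqVlt => /orP[/eqP-> //|]; apply: hf'.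
  by apply: ideal_addr hc => //; apply: mA; apply: mem_ideal_mul => //; exact: A1.
have [|i _|s nms hs] := @indep_perturb K A q.+1 V V' iK iA mA KA fl _ _ hV.
- by move=> i _; exact: AV.
- by rewrite /V'; case: ifP => [/hf[Wf _]|_]; [exact: A1|exact: ideal0].
have As u : W u -> A ((b0 + s * b1) * u).
  move=> Wu; rewrite mulrDl -mulrA; apply: idealD => //; first exact: A0.
  by apply: idealZl => //; exact: A1.
have := hmax s; rewrite leqNgt => /negP; apply.
apply: (indep_len R_local iK (iU _) (KU _) (flU _ As) _ hs).
move=> i _; have Us u : W u -> ideal_add K (scale (b0 + s * b1) W) ((b0 + s * b1) * u).
  by move=> Wu; apply: (ideal_add_subr iK); exact: mem_scale.
rewrite /V /V'; case: ifP => [/hf[Wf _]|_]; first by rewrite mulrA -mulrDl; exact: Us.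
rewrite mulr0 addr0; apply: (ideal_cancel_unit R_noeth R_local (iU _) nms).
have -> : s * (b1 * w) = (b0 + s * b1) * w - b0 * w by ring.
by apply: (idealB (iU _)); [exact: Us|exact: KU].
Qed.

(** * Number of generators of a power, and a reducing element *)

Section Powers.
Variables (I J : set R) (n : nat).
Hypotheses (iI : ideal I) (iJ : ideal J).

(** A / K is the degree n part of the fibre cone of the image of I in R / J; its length is the least
    number of generators of I^n modulo J. *)
Let K := ideal_add (ideal_mul m (ideal_exp I n)) J.
Let A := ideal_add (ideal_exp I n) J.
Hypothesis fl : finlen K A.

Lemma fiber_idealK : ideal K.
Proof. by apply: ideal_add_ideal => //; exact: ideal_mul_ideal. Qed.

Lemma fiber_idealA : ideal A.
Proof. by apply: ideal_add_ideal => //; exact: ideal_exp_ideal. Qed.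

Lemma fiber_sub : K `<=` A.
Proof. by apply: ideal_addS => //; apply: ideal_mul_subr; exact: ideal_exp_ideal. Qed.

Lemma fiber_mul : ideal_mul m A `<=` K.
Proof.
have iK := fiber_idealK; apply: ideal_mul_min iK _ => x _ mx [a ha [b Jb ->]].
exists (x * a); first exact: mem_ideal_mul.
by exists (x * b); [exact: idealZl|rewrite mulrDr].
Qed.

(* Take y of maximal rank; if c y I^(p+1) is too small, induction gives y' and
   maximality of the rank lets y' replace y. *)
Lemma eakin_sathaye_step p q (c : R) : (q + p.+1)%N = n -> ideal_exp I q c ->
  (len K (ideal_add K (scale c (ideal_exp I p.+1))) <= p.+1)%N ->
  exists2 y, I y & forall w, ideal_exp I p.+1 w ->
    ideal_add K (scale (c * y) (ideal_exp I p)) (c * w).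
Proof.
have iK := fiber_idealK; have iA := fiber_idealA; have KA := fiber_sub; have mA := fiber_mul.
have iE i := ideal_exp_ideal I i.
have iU b i : ideal (ideal_add K (scale b (ideal_exp I i))).
  by apply: ideal_add_ideal => //; exact: scale_ideal.
have KU b i : K `<=` ideal_add K (scale b (ideal_exp I i)).
  by apply: ideal_add_subl; exact: scale_ideal.
have memA i j b u : (i + j)%N = n -> ideal_exp I i b -> ideal_exp I j u -> A (b * u).
  by move=> e hb hu; apply: (ideal_add_subl iJ); rewrite -e; exact: mem_ideal_expD.
have UA b i j : (i + j)%N = n -> ideal_exp I i b -> ideal_add K (scale b (ideal_exp I j)) `<=` A.
  by move=> e hb; apply: ideal_add_min => //; apply: scale_min => u; exact: memA e hb.
have flU b i j : (i + j)%N = n -> ideal_exp I i b ->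
    finlen K (ideal_add K (scale b (ideal_exp I j))).
  by move=> e hb; apply: finlen_sub fl => //; exact: UA e hb.
elim: p q c => [|p IH] q c e hc hlen.
  have [h|] := pselect (forall w, ideal_exp I 1 w -> K (c * w)).
    by exists 0; [exact: ideal0|move=> w /h; exact: KU].
  move=> /existsNP[y /not_implyP[Iy Kcy]]; rewrite (ideal_exp1 iI) in Iy; exists y => // w Iw.
  have /addxP[k Kk [r ->]] : addx K (c * y) (c * w).
    apply: (@len_le1 _ K (ideal_add K (scale c (ideal_exp I 1)))) => //.
    - exact: flU e hc.
    - by apply: (ideal_add_subr iK); apply: mem_scale; exact: mem_ideal_exp1.
    - by apply: (ideal_add_subr iK); exact: mem_scale.
  by exists k => //; exists (c * y * r) => //; exists r.
have e' : (q.+1 + p.+1)%N = n by rewrite -e !addnS.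
have hcy y : I y -> ideal_exp I q.+1 (c * y) by move=> Iy; rewrite mulrC; exact: mem_ideal_mul.
pose P l := exists2 y, I y & len K (ideal_add K (scale (c * y) (ideal_exp I p.+1))) = l.
case: (@bounded_max P (len K A)).
- by exists (len K (ideal_add K (scale (c * 0) (ideal_exp I p.+1)))), 0 => //; exact: ideal0.
- move=> _ [y Iy <-]; have cy := hcy y Iy.
  by rewrite (@lenD _ K _ A iK (iU (c * y) p.+1)) ?leq_addr //; exact: UA e' cy.
move=> _ [[y Iy <-] ymax].
have [le|lt] := leqP (len K (ideal_add K (scale c (ideal_exp I p.+2))))
  (len K (ideal_add K (scale (c * y) (ideal_exp I p.+1)))).
  exists y => // w hw.
  apply: (len_le_eq (iU c p.+2) iK (iU (c * y) p.+1) _ _ _ le) => //.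
  - apply: ideal_add_min => //; apply: scale_min => a ha; rewrite -mulrA.
    by apply: (ideal_add_subr iK); apply: mem_scale; exact: mem_ideal_mul.
  - exact: flU e hc.
  - by apply: (ideal_add_subr iK); exact: mem_scale.
have [|y' Iy' hy'] := IH q.+1 (c * y) e' (hcy y Iy); first by rewrite -ltnS; exact: leq_trans hlen.
exists y' => // w hw; have iT := iU (c * y') p.+1.
apply: (ideal_mul_min (colon_ideal c iT) _ hw) => z {hw}w Iz hw.
suff : ideal_add K (scale (c * y') (ideal_exp I p.+1)) (c * (z * w)) by [].
have [k Kk [_ [w' hw' <-] ew]] := hy' w hw.
(* Since c y kills w2 modulo K, maximality of its rank puts c z w2 in K + c y I^(p+1), and this lies
   in K + c y' I^(p+1) by [hy']. *)
pose w2 := w - y' * w'.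
have hw2 : ideal_exp I p.+1 w2 by apply: (idealB (iE p.+1) hw); exact: mem_ideal_mul.
have Kw2 : K (c * y * w2).
  have -> : c * y * w2 = k by rewrite /w2 mulrBr ew; ring.
  by [].
have : ideal_add K (scale (c * y) (ideal_exp I p.+1)) (c * z * w2).
  apply: (@max_rank_kernel K A (ideal_exp I p.+1)) => //.
  - by move=> u; exact: memA e' (hcy y Iy).
  - by move=> u; exact: memA e' (hcy z Iz).
  - move=> s; apply: ymax; exists (y + s * z); first by apply: idealD => //; exact: idealZl.
    by congr (len K (ideal_add K (scale _ _))); ring.
move=> [k1 Kk1 [_ [u hu <-] eu]].
have -> : c * (z * w) = k1 + c * y * u + c * y' * (z * w') by rewrite -eu /w2; ring.
apply: idealD => //; last by apply: (ideal_add_subr iK); apply: mem_scale; exact: mem_ideal_mul.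
apply: idealD => //; first exact: KU.
have [k2 Kk2 [_ [u' hu' <-] ->]] := hy' u hu; apply: idealD => //; first exact: KU.
have -> : c * y * y' * u' = c * y' * (y * u') by ring.
by apply: (ideal_add_subr iK); apply: mem_scale; exact: mem_ideal_mul.
Qed.

(** The step with c = 1 places I^n in y I^(n-1) + m I^n + J, and Nakayama removes m I^n. *)
Theorem eakin_sathaye : (0 < n)%N -> (len K A <= n)%N ->
  exists2 y, I y & ideal_exp I n `<=` ideal_add (scale y (ideal_exp I n.-1)) J.
Proof.
move=> n0 hlen; have iK := fiber_idealK; have iE i := ideal_exp_ideal I i.
have eA : ideal_add K (scale 1 (ideal_exp I n)) = A.
  apply/seteqP; split.
    apply: ideal_add_min; [exact: fiber_idealA|exact: fiber_sub|].
    by apply: scale_min => a; rewrite mul1r; exact: (ideal_add_subl iJ).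
  apply: ideal_add_min.
  - by apply: ideal_add_ideal => //; exact: scale_ideal.
  - by move=> a ha; apply: (ideal_add_subr iK); rewrite -(mul1r a); exact: mem_scale.
  - apply: subset_trans (ideal_add_subl _); last exact: scale_ideal.
    by apply: ideal_add_subr; exact: ideal_mul_ideal.
have := @eakin_sathaye_step n.-1 0 1; rewrite prednK // eA.
move=> /(_ (add0n n) Logic.I hlen)[y Iy hy]; exists y => //.
have iB : ideal (ideal_add (scale y (ideal_exp I n.-1)) J).
  by apply: ideal_add_ideal => //; exact: scale_ideal.
apply: (nakayama R_noeth R_local) => // w hw.
have := hy w hw; rewrite !mul1r => -[_ [a ha [b Jb ->]] [_ [v hv <-] ->]].
exists (y * v + b); first by exists (y * v); [exact: mem_scale|exists b].
by exists a => //; ring.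
Qed.

End Powers.
End EakinSathaye.

(** * Dimension one *)

Section IdealProducts.
Variable R : comNzRingType.
Implicit Types (A B C J : set R) (x y z u v : R).

Lemma ideal_mulA A B C : ideal_mul (ideal_mul A B) C = ideal_mul A (ideal_mul B C).
Proof.
apply/seteqP; split; apply: ideal_mul_min; try exact: ideal_mul_ideal.
  move=> u z hu Cz; rewrite mulrC.
  apply: (ideal_mul_min (colon_ideal z (ideal_mul_ideal _ _)) _ hu) => x y Ax By.
  by rewrite /colon /= mulrC -mulrA; apply: mem_ideal_mul => //; exact: mem_ideal_mul.
move=> x u Ax; apply: (ideal_mul_min (colon_ideal x (ideal_mul_ideal _ _))) => y z By Cz.
by rewrite /colon /= mulrA; apply: mem_ideal_mul => //; exact: mem_ideal_mul.
Qed.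

Lemma ideal_mul1 A : ideal A -> ideal_mul setT A = A.
Proof.
move=> iA; apply/seteqP; split; first exact: ideal_mul_subr.
by move=> x Ax; rewrite -(mul1r x); exact: mem_ideal_mul.
Qed.

Lemma nzd_dvd J x y v : ideal J -> nzd J x -> J (x - y * v) -> nzd J y.
Proof.
move=> iJ xJ h u hu; apply: xJ.
have -> : x * u = u * (x - y * v) + v * (y * u) by ring.
by apply: idealD => //; exact: idealZl.
Qed.

Lemma nzd_proper J x : ideal J -> ~ J 1 -> nzd J x -> ~ J x.
Proof. by move=> iJ J1 xJ Jx; apply/J1/xJ; rewrite mulr1. Qed.

End IdealProducts.

Lemma binom2E (a : int) : 2 * binom2 a = a * (a - 1).
Proof.
rewrite /binom2 mulrC divzK //.
have [b ->] : exists b : int, a * (a - 1) = b * 2.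
  have := divz_eq a 2; have := modz_ge0 a (isT : (2 : int) != 0).
  have := ltz_mod a (isT : (2 : int) != 0); set r := (a %% 2)%Z; set b := (a %/ 2)%Z.
  move=> r2 r0 ->; have [->|->] : r = 0 \/ r = 1 by lia.
    by exists (b * (b * 2 - 1)); ring.
  by exists (b * (b * 2 + 1)); ring.
by apply/dvdzP; exists b.
Qed.

Section DimensionOne.
Variables (R : comNzRingType) (m I J : set R) (t : nat -> R) (k N : nat) (a : R) (e0 e1 : int).
Hypotheses (R_noeth : noetherian R) (R_local : local_ring m).
Hypotheses (t_diff : forall i j, i != j -> ~ m (t i - t j)).
Hypotheses (iI : ideal I) (I_rad : forall b, m b -> exists n, I (b ^+ n)).
Hypotheses (k_ge2 : (2 <= k)%N) (Imk : I `<=` ideal_exp m k).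
Hypotheses (iJ : ideal J) (Jm : J `<=` m) (ma : m a) (aJ : nzd J a).

(** Modulo J these are m^j I^n, I^n and the Hilbert function. The estimate of [H n] runs along P n =
    Q 0 n, Q 1 n, ..., Q k n, which contains P n.+1. *)
Let Q j n := ideal_add (ideal_mul (ideal_exp m j) (ideal_exp I n)) J.
Let P n := ideal_add (ideal_exp I n) J.
Let H n := len (P n.+1) (P n).

Hypothesis fin : forall n, (N <= n)%N -> finlen (P n.+1) setT.
Hypothesis hilb : forall n, (N <= n)%N -> (len (P n.+1) setT)%:Z = e0 * n.+1%:Z - e1.

Let iE n : ideal (ideal_exp I n) := ideal_exp_ideal I n.
Let im : ideal m := max_ideal R_local.

Lemma m_exp_sub j : ideal_exp m j.+1 `<=` m.
Proof. by move=> x /(ideal_exp_le (ltn0Sn j)); rewrite ideal_exp1. Qed.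

Lemma I_sub_m : I `<=` m.
Proof. by move=> x /Imk; case: k k_ge2 => // j _; exact: m_exp_sub. Qed.

Lemma J_proper : ~ J 1. Proof. by move=> /Jm; exact: max_proper R_local. Qed.

Lemma P_ideal n : ideal (P n). Proof. exact: ideal_add_ideal. Qed.

Lemma P_le i j : (i <= j)%N -> P j `<=` P i.
Proof. by move=> ij; apply: ideal_addS => //; exact: ideal_exp_le. Qed.

Lemma P0 : P 0 = setT.
Proof. by apply: ideal1_setT; [exact: P_ideal|exact: ideal_add_subl]. Qed.

Lemma P_fin n A B : P n `<=` B -> finlen B A.
Proof.
move=> PB; apply: (@finlen_sub _ (P (maxn N n).+1) setT) => //; last by apply: fin; exact: leq_maxl.
apply: subset_trans PB; apply: P_le; apply: leqW; exact: leq_maxr.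
Qed.

Lemma len_P n : len (P n) setT = (\sum_(i < n) H i)%N.
Proof.
elim: n => [|n IH].
  rewrite big_ord0 P0; apply: len_eq; split; first exact: chain_length0.
  move=> [//|l [c [Pc ltc]]]; have [_ h _] := Pc 0%N isT.
  by case: (ltc 0%N isT) => _; case; apply: subset_trans h.
rewrite big_ord_recr /= -IH addnC; apply: lenD => //; try exact: P_ideal.
  exact: P_le.
exact: P_fin (@subset_refl _ _).
Qed.

Lemma hilb_sum n : (N <= n)%N -> (\sum_(i < n.+1) (H i)%:Z) = e0 * n.+1%:Z - e1.
Proof. by move=> /hilb <-; rewrite len_P -(big_morph _ PoszD (erefl 0%:Z)). Qed.

Lemma H_large n : (N < n)%N -> (H n)%:Z = e0.
Proof.
case: n => // n nN; have := hilb_sum (leqW nN); rewrite big_ord_recr /= hilb_sum //.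
have -> : n.+2%:Z = n.+1%:Z + 1 by lia.
by rewrite mulrDr; lia.
Qed.

Lemma reduction_step y r n : I y -> ideal_exp I r.+1 `<=` ideal_add (scale y (ideal_exp I r)) J ->
  (r <= n)%N -> ideal_exp I n.+1 `<=` ideal_add (scale y (ideal_exp I n)) J.
Proof.
move=> Iy hy /subnKC <-; elim: (n - r)%N => [|p IH]; first by rewrite addn0.
rewrite addnS; apply: ideal_mul_min; first by apply: ideal_add_ideal => //; exact: scale_ideal.
move=> z w Iz /IH[_ [v hv <-] [j Jj ->]]; exists (y * (z * v)).
  by apply: mem_scale; exact: mem_ideal_mul.
by exists (z * j); [exact: idealZl|ring].
Qed.

Lemma P_nzd n : exists2 x, ideal_exp I n x & nzd J x.
Proof.
have [M hM] := I_rad ma; exists ((a ^+ M) ^+ n); first exact: mem_ideal_expX.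
by rewrite -exprM; exact: nzdX.
Qed.

(** Multiplication by y maps P n / P n.+1 isomorphically onto the next layer: surjectively because
    I^(n+1) = y I^n modulo J, injectively because y divides, modulo J, a nonzerodivisor in
    I^(r+1). *)
Lemma H_const y r n : I y -> ideal_exp I r.+1 `<=` ideal_add (scale y (ideal_exp I r)) J ->
  (r <= n)%N -> H n = H r.
Proof.
move=> Iy hy; have step p : (r <= p)%N -> H p.+1 = H p.
  move=> rp; have yJ : nzd J y.
    have [x hx xJ] := P_nzd r.+1; have [_ [v _ <-] [j Jj ex]] := hy x hx.
    by apply: (@nzd_dvd _ J x y v) => //; rewrite ex addrC addKr.
  have yP p' u : P p' u -> P p'.+1 (y * u).
    by move=> hu; rewrite -add1n; apply: add_expM => //; exact: mem_ideal_exp1.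
  have hyP p' : (r <= p')%N -> P p'.+1 `<=` ideal_add (scale y (ideal_exp I p')) J.
    move=> rp'; apply: ideal_add_min; first by apply: ideal_add_ideal => //; exact: scale_ideal.
      exact: reduction_step hy rp'.
    by apply: ideal_add_subr; exact: scale_ideal.
  have := len_mul y (P_ideal p.+2) (P_ideal p).
  have -> : ideal_add (P p.+2) (scale y (P p)) = P p.+1.
    apply/seteqP; split.
      apply: ideal_add_min; [exact: P_ideal|exact: P_le|apply: scale_min; exact: yP].
    move=> x /(hyP _ rp)[_ [v hv <-] [j Jj ->]]; exists j.
      exact: ideal_add_subr.
    exists (y * v); last by rewrite addrC.
    by apply: mem_scale; exact: ideal_add_subl.
  suff -> : colon (P p.+2) y `&` P p = P p.+1 by [].
  apply/seteqP; split=> [u [hu _]|u hu]; last by split; [exact: yP|exact: P_le hu].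
  have [_ [v hv <-] [j Jj e]] := hyP _ (leqW rp) _ hu; exists v => //; exists (u - v).
    by apply: yJ; rewrite mulrBr e addrC addKr.
  by rewrite addrC subrK.
move=> /subnKC <-; elim: (n - r)%N => [|p IH]; first by rewrite addn0.
by rewrite addnS step ?leq_addr.
Qed.

Lemma e1_eq y r : I y -> ideal_exp I r.+1 `<=` ideal_add (scale y (ideal_exp I r)) J ->
  e1 = e0 * r%:Z - \sum_(i < r) (H i)%:Z.
Proof.
move=> Iy hy; have Hr : (H r)%:Z = e0.
  by rewrite -(H_const Iy hy (leq_maxl r N.+1)) H_large //; exact: leq_maxr.
have hsum p : \sum_(i < r + p) (H i)%:Z = \sum_(i < r) (H i)%:Z + e0 * p%:Z.
  elim: p => [|p IH]; first by rewrite addn0 mulr0 addr0.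
  rewrite addnS big_ord_recr /= IH (H_const Iy hy (leq_addr _ _)) Hr.
  have -> : p.+1%:Z = p%:Z + 1 by lia.
  by rewrite mulrDr mulr1 addrA.
have := @hilb_sum (r + N)%N (leq_addl _ _); rewrite -addnS hsum => e.
by move: e; rewrite PoszD mulrDr; lia.
Qed.

Lemma Q_ideal j n : ideal (Q j n).
Proof. by apply: ideal_add_ideal => //; exact: ideal_mul_ideal. Qed.

Lemma Q0 n : Q 0 n = P n.
Proof. by rewrite /Q ideal_mul1. Qed.

Lemma QS_sub j n : Q j.+1 n `<=` Q j n.
Proof. by apply: ideal_addS => //; apply: ideal_mulSl; exact: ideal_expS. Qed.

Lemma Q_sub_P j n : Q j n `<=` P n.
Proof. by apply: ideal_addS => //; exact: ideal_mul_subr. Qed.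

Lemma P_sub_Q n : P n.+1 `<=` Q k n.
Proof. by apply: ideal_addS => //; exact: ideal_mulSl. Qed.

Lemma P_sub_Qj j n : P (j + n) `<=` Q j n.
Proof.
apply: ideal_addS => //; apply: ideal_exp_min => [|x y hx hy]; first exact: ideal_mul_ideal.
apply: mem_ideal_mul => //; move: x hx; elim: (j) => // i IH.
apply: ideal_mul_min; first exact: ideal_exp_ideal.
by move=> x y' /I_sub_m mx /IH; exact: mem_ideal_mul.
Qed.

Lemma Q_fin j n A : finlen (Q j n) A.
Proof. exact: P_fin (@P_sub_Qj j n). Qed.

Lemma Q_nzd j n : exists2 x, ideal_mul (ideal_exp m j) (ideal_exp I n) x & nzd J x.
Proof.
have [x hx xJ] := P_nzd n; exists (a ^+ j * x).
  by apply: mem_ideal_mul => //; exact: mem_ideal_expX.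
by move=> u; rewrite -mulrA => /(nzdX aJ) /xJ.
Qed.

(** Equality would put m^j I^n inside J by Nakayama, although it contains a nonzerodivisor modulo
    J. *)
Lemma Q_strict j n : ~ (Q j n `<=` Q j.+1 n).
Proof.
move=> h; have [x hx xJ] := Q_nzd j n; apply: (nzd_proper iJ J_proper xJ).
apply: (nakayama R_noeth R_local _ iJ _ hx); first exact: ideal_mul_ideal.
by rewrite -ideal_mulA ideal_addC => z hz; apply: h; exact: ideal_add_subl.
Qed.

Lemma len_Q_gt0 j n : (0 < len (Q j.+1 n) (Q j n))%N.
Proof.
exact: (len_gt0 (Q_ideal j n) (Q_ideal j.+1 n) (@QS_sub j n) (Q_fin _ _ _) (@Q_strict j n)).
Qed.

(** Suppose b generates m I^n modulo J. Not all products a0 b0 lie in J + b m, so one of them is b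
    times a unit modulo J. Then b0 is a nonzerodivisor, z b0 is a multiple of a0 b0 for each z in m,
    and cancelling b0 shows that a0 generates m modulo J. *)
Lemma len_Q1_ge2 n : (forall g, m g -> ~ (m `<=` addx J g)) -> (2 <= len (Q 2 n) (Q 1 n))%N.
Proof.
move=> m_npr; rewrite leqNgt ltnS; apply/negP => l1.
set A := ideal_mul m (ideal_exp I n).
have eQ1 : Q 1 n = ideal_add A J by rewrite /Q ideal_exp1.
have em2 : ideal_exp m 2 = ideal_mul m m.
  by rewrite -[LHS]/(ideal_mul m (ideal_exp m 1)) ideal_exp1.
have eQ2 : Q 2 n = ideal_add (ideal_mul m A) J by rewrite /Q em2 ideal_mulA.
have iA : ideal A by exact: ideal_mul_ideal.
have [b Ab Qb] : exists2 b, A b & ~ Q 2 n b.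
  apply: contrapT => h; apply: (@Q_strict 1 n); rewrite eQ1.
  apply: ideal_add_min; first exact: Q_ideal.
    by move=> b Ab; apply: contrapT => nb; apply: h; exists b.
  by apply: ideal_add_subr; exact: ideal_mul_ideal.
have iJb := addx_ideal b iJ.
have AJb : A `<=` addx J b.
  apply: (nakayama R_noeth R_local) => // z Az.
  have : addx (Q 2 n) b z.
    apply: (@len_le1 _ (Q 2 n) (Q 1 n)) => //; try exact: Q_ideal.
    - exact: QS_sub.
    - exact: Q_fin.
    - by rewrite eQ1; exact: ideal_add_subl.
    - by rewrite eQ1; exact: ideal_add_subl.
  rewrite eQ2 => /addxP[_ [w hw [j Jj ->]] [r ->]].
  by exists (j + b * r); [apply/addxP; exists j => //; exists r|exists w => //; ring].
have bJ : nzd J b.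
  have [x] := Q_nzd 1 n; rewrite (ideal_exp1 im) => /AJb /addxP[j Jj [r ->]] xJ.
  by apply: (@nzd_dvd _ J _ b r iJ xJ); rewrite addrK.
have iT : ideal (ideal_add J (scale b m)) by apply: ideal_add_ideal => //; exact: scale_ideal.
have [a0 [b0 [ma0 hb0 nT]]] : exists a0 b0,
    [/\ m a0, ideal_exp I n b0 & ~ ideal_add J (scale b m) (a0 * b0)].
  apply: contrapT => h; have : ideal_add J (scale b m) b.
    apply: (ideal_mul_min iT) Ab => x y mx hy; apply: contrapT => nxy; apply: h.
    by exists x, y.
  move=> [j Jj [_ [u mu <-] e]]; apply: (nzd_proper iJ J_proper bJ).
  apply: (ideal_cancel_1B R_noeth R_local iJ mu).
  by rewrite {1}e mulrC addrK.
have [j Jj [r er]] : exists2 j, J j & exists r, a0 * b0 = j + b * r.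
  by apply/addxP; apply: AJb; exact: mem_ideal_mul.
have [e ee] : exists e, r * e = 1.
  apply: (notin_max_unit R_noeth R_local) => mr; apply: nT.
  by rewrite er; exists j => //; exists (b * r) => //; exact: mem_scale.
have b0J : nzd J b0.
  apply: (@nzd_dvd _ J b _ (a0 * e)) => //.
  have -> : b - b0 * (a0 * e) = b * (1 - r * e) - e * j.
    have -> : b0 * (a0 * e) = (a0 * b0) * e by ring.
    by rewrite er; ring.
  by rewrite ee subrr mulr0 sub0r; apply: idealN => //; exact: idealZl.
apply: (m_npr a0 ma0) => z mz.
have [j1 Jj1 [r1 er1]] : exists2 j, J j & exists r, z * b0 = j + b * r.
  by apply/addxP; apply: AJb; exact: mem_ideal_mul.
apply/addxP; exists (z - a0 * (r1 * e)); last by exists (r1 * e); rewrite subrK.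
apply: b0J; have -> : b0 * (z - a0 * (r1 * e)) = z * b0 - (a0 * b0) * (r1 * e) by ring.
rewrite er1 er.
have -> : j1 + b * r1 - (j + b * r) * (r1 * e) = j1 - (r1 * e) * j + b * r1 * (1 - r * e) by ring.
by rewrite ee subrr mulr0 addr0; apply: idealB => //; exact: idealZl.
Qed.

(* Compare I with the largest power of g dividing it modulo J. *)
Lemma principal_mod g : m g -> m `<=` addx J g -> exists2 y, I y & I `<=` addx J y.
Proof.
move=> mg mJg; have gJ : nzd J g.
  have /addxP[j Jj [r ea]] := mJg a ma.
  by apply: (@nzd_dvd _ J a g r) => //; rewrite ea addrK.
have [M gM] := I_rad mg.
case: (@bounded_max (fun s => I `<=` addx J (g ^+ s)) M).
- exists 0%N => x _; apply/addxP; exists 0; first exact: ideal0.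
  by exists x; rewrite expr0 mul1r add0r.
(* A power g^M in I bounds s: for s > M, g^M = g^s r modulo J, and since 1 - g^(s-M) r is a unit
   this would put g^M in J. *)
- move=> s hs; rewrite leqNgt; apply/negP => Ms.
  have /addxP[j Jj [r e]] := hs _ gM.
  apply: (nzd_proper iJ J_proper (nzdX (n := M) gJ)).
  apply: (ideal_cancel_1B (x := g ^+ (s - M) * r) R_noeth R_local iJ).
    by apply: idealZr => //; rewrite -(prednK (n := s - M)) ?subn_gt0 // exprS; exact: idealZr.
  have -> : g ^+ M - g ^+ (s - M) * r * g ^+ M = g ^+ M - g ^+ s * r.
    by rewrite -{2}(subnK (ltnW Ms)) exprD; ring.
  by rewrite {1}e addrK.
move=> s [hs smax].
(* Maximality of s yields an element of I equal to g^s times a unit modulo J; it generates I modulo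
   J. *)
have [y [Iy [j Jj [c [ey nc]]]]] : exists
    y, I y /\ exists2 j, J j & exists c, y = j + g ^+ s * c /\ ~ m c.
  apply: contrapT => h.
  suff : I `<=` addx J (g ^+ s.+1) by move=> /smax; rewrite ltnn.
  move=> x Ix.
  have /addxP[j Jj [c ex]] := hs x Ix.
  have mc : m c by apply: contrapT => nc; apply: h; exists x; split=> //; exists j => //; exists c.
  have /addxP[j' Jj' [c' ec]] := mJg c mc.
  apply/addxP; exists (j + g ^+ s * j'); first by apply: idealD => //; exact: idealZl.
  by exists c'; rewrite ex ec exprS; ring.
exists y => // x /hs; apply: addx_min; [exact: addx_ideal|exact: sub_addx|].
apply: (ideal_cancel_unit R_noeth R_local (addx_ideal y iJ) nc).
have -> : c * g ^+ s = y - j by rewrite ey; ring.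
apply: (idealB (addx_ideal y iJ)); [exact: mem_addx|exact: sub_addx].
Qed.

Lemma H_ge n : (forall g, m g -> ~ (m `<=` addx J g)) -> (n < len (Q 1 n) (P n))%N ->
  (n + k < H n)%N.
Proof.
move=> m_npr hn.
have key j : (n + j.+2 < len (Q j.+2 n) (P n))%N.
  elim: j => [|j IH].
    rewrite (lenD (Q_ideal 2 n) (Q_ideal 1 n) (P_ideal n) (@QS_sub 1 n)
      (@Q_sub_P 1 n) (Q_fin _ _ _)).
    by have := len_Q1_ge2 n m_npr; lia.
  rewrite (lenD (Q_ideal j.+3 n) (Q_ideal j.+2 n) (P_ideal n) (@QS_sub j.+2 n)
    (@Q_sub_P j.+2 n) (Q_fin _ _ _)).
  by have := len_Q_gt0 j.+2 n; lia.
have := key (k - 2)%N; have -> : (k - 2).+2 = k by lia.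
move=> h; apply: leq_trans h _.
rewrite /H (lenD (P_ideal n.+1) (Q_ideal k n) (P_ideal n) (@P_sub_Q n) (@Q_sub_P k n)) ?leq_addl //.
exact: P_fin (@subset_refl _ _).
Qed.

Lemma sum_bound r : (forall i, (i < r)%N -> (i + k < H i)%N) ->
  2 * (e0 * r%:Z - \sum_(i < r) (H i)%:Z) <= (e0 - k%:Z) * (e0 - k%:Z - 1).
Proof.
move=> h; have : 2 * (e0 * r%:Z - \sum_(i < r) (H i)%:Z) <=
    2 * r%:Z * (e0 - k%:Z - 1) - r%:Z * (r%:Z - 1).
  elim: r h => [|r IH] h; first by rewrite big_ord0; lia.
  have {}IH := IH (fun i ir => h i (leqW ir)); have hr := h r (ltnSn r).
  rewrite big_ord_recr /=; set S := \sum_(i < r) _ in IH *.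
  have -> : r.+1%:Z = r%:Z + 1 by lia.
  have {}hr : r%:Z + k%:Z + 1 <= (H r)%:Z by lia.
  by nia.
move=> h'; apply: le_trans h' _; rewrite -subr_ge0.
set E := e0 - k%:Z; have -> : E * (E - 1) - (2 * r%:Z * (E - 1) - r%:Z * (r%:Z - 1)) =
  (E - r%:Z) * (E - r%:Z - 1) by ring.
(* A product of two consecutive integers is nonnegative, whatever the sign of D. *)
by set D := E - r%:Z; have [D0|D0] := leP 1 D; nia.
Qed.

Theorem dimension_one_bound : e1 <= binom2 (e0 - k%:Z).
Proof.
have conclude y r : I y -> ideal_exp I r.+1 `<=` ideal_add (scale y (ideal_exp I r)) J ->
    (forall i, (i < r)%N -> (i + k < H i)%N) -> e1 <= binom2 (e0 - k%:Z).
  move=> Iy hy hH; have := sum_bound hH; rewrite -(e1_eq Iy hy) -binom2E; lia.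
(* If I is principal modulo J, then r = 0 works and the condition on i < r is empty. *)
have [[y Iy hy]|npr] := pselect (exists2 y, I y & I `<=` addx J y).
  by apply: (conclude y 0) => //; rewrite ideal_exp1 // ideal_addC.
have m_npr g : m g -> ~ (m `<=` addx J g).
  by move=> mg mJg; apply: npr; exact: principal_mod mJg.
have [n [[n0 hn] nmin]] : exists n, ((0 < n)%N /\ (len (Q 1 n) (P n) <= n)%N) /\
    forall j, (j < n)%N -> ~ ((0 < j)%N /\ (len (Q 1 j) (P j) <= j)%N).
  (* Beyond N the number of generators of I^n modulo J is at most H n = e0, so it no longer exceeds
     n once n > |e0|. *)
  apply: has_min; pose n := (maxn N `|e0|%N).+1; exists n; split=> //.
  have hH : (H n)%:Z = e0 by apply: H_large; rewrite ltnS leq_maxl.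
  have : (H n <= n)%N by rewrite -[H n]absz_nat hH leqW // leq_maxr.
  apply: leq_trans; rewrite /H.
  rewrite (lenD (P_ideal n.+1) (Q_ideal 1 n) (P_ideal n) (@P_sub_Qj 1 n)
    (@Q_sub_P 1 n)) ?leq_addl //.
  exact: P_fin (@subset_refl _ _).
have eK : ideal_add (ideal_mul m (ideal_exp I n)) J = Q 1 n by rewrite /Q ideal_exp1.
have [||y Iy hy] := @eakin_sathaye _ m t R_noeth R_local t_diff I J n iI iJ _ n0.
- by rewrite eK; exact: Q_fin.
- by rewrite eK.
apply: (conclude y n.-1) => //; first by rewrite prednK.
move=> i ir; apply: H_ge => //.
(* Minimality of n concerns positive exponents only; I^0 = R needs one generator. *)
have [->|i0] := posnP i; first by rewrite -Q0; exact: len_Q_gt0.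
rewrite ltnNge; apply/negP => hi; apply: (nmin i); last by [].
by apply: leq_trans ir _; exact: leq_pred.
Qed.

End DimensionOne.

(** * Reduction to dimension one *)

Section DimensionInduction.
Variables (R : comNzRingType) (m I : set R) (t : nat -> R) (c : seq R) (k : nat) (e : nat -> int).
Hypotheses (R_noeth : noetherian R) (R_local : local_ring m).
Hypotheses (t_diff : forall i j, i != j -> ~ m (t i - t j)).
Hypotheses (iI : ideal I) (I_rad : forall b, m b -> exists n, I (b ^+ n)).
Hypotheses (I_gen : I = ideal_gen [set` c]) (k_ge2 : (2 <= k)%N) (Imk : I `<=` ideal_exp m k).
Implicit Types (J : set R) (s : seq R).

Fixpoint regular_mod J s : Prop :=
  if s is a :: s' then [/\ m a, nzd J a & regular_mod (addx J a) s'] else True.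

(** Regularity of x is asked modulo each proper initial segment of s, but not modulo all of s. *)
Fixpoint nzd_along x J s : Prop :=
  if s is a :: s' then nzd J x /\ nzd_along x (addx J a) s' else True.

Lemma moment_nzd_along J s : ideal J -> regular_mod J s ->
  exists n0, forall j, (n0 <= j)%N -> nzd_along (moment t c j) J s.
Proof.
elim: s J => [|a s IH] J iJ /=; first by exists 0%N.
move=> [ma aJ /(IH _ (addx_ideal a iJ))[n1 h1]].
have [n2 h2] := moment_nzd R_noeth R_local t_diff I_rad I_gen iJ ma aJ.
exists (maxn n1 n2) => j; rewrite geq_max => /andP[nj1 nj2].
by split; [exact: h2|exact: h1].
Qed.

(** Repeated use of [nzd_swap] moves x to the front; the last element b is given up in exchange,
    matching the drop in dimension. *)
Lemma regular_mod_addx x J s b : ideal J -> regular_mod J (rcons s b) ->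
  nzd_along x J (rcons s b) -> regular_mod (addx J x) s.
Proof.
elim: s J => [//|a s IH] J iJ /= [ma aJ hs] [xJ hx]; have iJa := addx_ideal a iJ.
split=> //; last by rewrite addxC; exact: IH.
apply: nzd_swap => //; by case: (s) hx => [|? ?] [].
Qed.

Definition hilbert_mod d J := exists N, forall n, (N <= n)%N ->
  finlen (ideal_add (ideal_exp I n.+1) J) setT /\
  (len (ideal_add (ideal_exp I n.+1) J) setT)%:Z =
    \sum_(i < d.+1) (-1) ^+ i * e i * 'C(n + d - i, d - i)%:Z.

(** Superficiality makes the length modulo x the difference of two consecutive lengths modulo J. By
    Pascal's rule each binomial drops by one in both the summation degree and its role, the constant
    term cancels, and e_0, ..., e_d are unchanged. *)
Lemma hilbert_mod_addx d J x : ideal J -> hilbert_mod d.+1 J ->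
  (exists N, forall n, (N <= n)%N ->
    colon (ideal_add (ideal_exp I n.+1) J) x = ideal_add (ideal_exp I n) J) ->
  hilbert_mod d (addx J x).
Proof.
move=> iJ [N hN] [N' hN']; exists (maxn N N').+1; case=> // n; rewrite ltnS geq_max.
move=> /andP[Nn N'n]; set P := fun n => ideal_add (ideal_exp I n) J.
have iP p : ideal (P p) by apply: ideal_add_ideal => //; exact: ideal_exp_ideal.
have eP p : ideal_add (ideal_exp I p) (addx J x) = addx (P p) x by rewrite /addx ideal_addA.
have [fl1 h1] := hN n Nn; have [fl2 h2] := hN n.+1 (leqW Nn).
rewrite eP; split; first by apply: finlen_sub fl2 => //; exact: sub_addx.
have := lenD (iP n.+2) (addx_ideal x (iP n.+2)) (@idealT R) (@sub_addx _ _ _) (@subsetT _ _) fl2.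
rewrite {2}/addx len_mul // setIT hN' ?(leqW N'n) // => eq_len.
have -> : (len (addx (P n.+2) x) setT)%:Z =
    (len (P n.+2) setT)%:Z - (len (P n.+1) setT)%:Z by rewrite eq_len PoszD addrC addKr.
rewrite h1 h2 big_ord_recr /= [X in _ - X]big_ord_recr /= !subnn !bin0.
rewrite opprD addrACA subrr addr0 -sumrB; apply: eq_bigr => i _; rewrite -mulrBr; congr (_ * _).
have id : (i <= d)%N by rewrite -ltnS.
have -> : (n.+1 + d.+1 - i = (n + d.+1 - i).+1)%N by lia.
have -> : (n.+1 + d - i = n + d.+1 - i)%N by lia.
have -> : (d.+1 - i = (d - i).+1)%N by lia.
by rewrite binS PoszD addrC addKr.
Qed.

(** The number d + 1 plays the part of dim R / J. Passing from J to J + xR keeps the function [e],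
    so the bound found in dimension one is already the required one. *)
Theorem hilbert_bound d J s : ideal J -> J `<=` m -> regular_mod J s -> size s = d.+1 ->
  hilbert_mod d.+1 J -> e 1%N <= binom2 (e 0%N - k%:Z).
Proof.
elim: d J s => [|d IH] J s iJ Jm hs sz hJ.
  case: s sz hs => [|a [|]] //= _ [ma aJ _]; have [N hN] := hJ.
  apply: (@dimension_one_bound R m I J t k N a (e 0%N) (e 1%N)) => // n /hN[] // _ ->.
  by rewrite big_ord_recr big_ord1 /= expr0 expr1 mul1r !subn0 addn1 subSS subn0 bin0 bin1; ring.
case/lastP: s sz hs => // s b; rewrite size_rcons => -[sz] hs.
have [n1 h1] := moment_nzd_along iJ hs.
have [n2 h2] := moment_superficial R_noeth R_local t_diff iI I_gen iJ.
(* One index serves both demands: regularity along s and superficiality. *)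
set j := maxn n1 n2; have hx := h1 j (leq_maxl _ _).
have xJ : nzd J (moment t c j) by case: (s) hx => [|? ?] [].
apply: (IH (addx J (moment t c j)) s) => //; first exact: addx_ideal.
- apply: addx_min => //; first exact: max_ideal.
  exact: (I_sub_m R_local k_ge2 Imk (moment_in t iI I_gen j)).
- exact: regular_mod_addx hs hx.
- by apply: hilbert_mod_addx => //; apply: h2 => //; exact: leq_maxr.
Qed.

End DimensionInduction.

(** * Passage from the data of the statement to sequences and lengths modulo J *)

Section Transfer.
Variable R : comNzRingType.
Implicit Types (m I J : set R) (s : seq R).

(** Representatives are chosen along an injection of the natural numbers into the set of cosets. *)
Lemma residue_seq m : ideal m -> infinite_set (residue_field m) ->
  exists t : nat -> R, forall i j, i != j -> ~ m (t i - t j).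
Proof.
move=> im /infiniteP/pcard_leP/unsquash f.
have : forall i, exists x, f i = [set y | m (y - x)].
  move=> i; have [x _ <-] : residue_field m (f i) by apply: funS.
  by exists x.
move=> /choice[t ht]; exists t => i j ij mij.
suff fij : f i = f j.
  by move: ij; rewrite (@inj _ _ _ f i j _ _ fij) ?inE // eqxx.
rewrite !ht; apply/seteqP; split=> y /= hy.
  have -> : y - t j = (y - t i) + (t i - t j) by ring.
  exact: idealD.
have -> : y - t i = (y - t j) - (t i - t j) by ring.
exact: idealB.
Qed.

Lemma ideal_gen_rcons s x : ideal_gen [set` rcons s x] = addx (ideal_gen [set` s]) x.
Proof.
have iG := ideal_gen_ideal [set` s]; apply/seteqP; split.
  apply: ideal_gen_min; first exact: addx_ideal.
  move=> y /=; rewrite mem_rcons inE => /orP[/eqP->|ys]; first exact: mem_addx.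
  by apply: sub_addx; exact: sub_ideal_gen.
apply: addx_min; first exact: ideal_gen_ideal.
  apply: ideal_gen_min => [|y ys]; first exact: ideal_gen_ideal.
  by apply: sub_ideal_gen; rewrite /= mem_rcons inE ys orbT.
by apply: sub_ideal_gen; rewrite /= mem_rcons mem_head.
Qed.

Lemma regular_seq_mod m s : [set` s] `<=` m -> regular_seq s ->
  regular_mod m (ideal_gen [set` ([::] : seq R)]) s.
Proof.
move=> sm [reg _].
suff h l2 l1 : l1 ++ l2 = s -> regular_mod m (ideal_gen [set` l1]) l2 by exact: (h s [::]).
elim: l2 l1 => [//|a l2 IH] l1 e /=; split.
- by apply: sm; rewrite /= -e mem_cat mem_head orbT.
- move=> u; have := reg (size l1) _ u.
  by rewrite -e take_size_cat // nth_cat ltnn subnn /=; apply; rewrite size_cat /=; lia.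
- by rewrite -ideal_gen_rcons; apply: IH; rewrite cat_rcons.
Qed.

Lemma quot_lengthP J l : quot_length J l -> finlen J setT /\ len J setT = l.
Proof.
have -> : quot_length J l = is_max (chain_lengths (between J setT)) l.
  rewrite /quot_length (_ : [set K | ideal K /\ J `<=` K] = between J setT) //.
  by apply/seteqP; split=> K [iK JK].
by move=> h; split; [exact: finlen_max h|exact: len_eq].
Qed.

End Transfer.

Theorem corollary3p7 (R : comNzRingType) (m : set R) (d : nat)
    (I : set R) (k : nat) (e : nat -> int)
    (R_noeth : noetherian R) (R_local : local_ring m)
    (R_CM : cohen_macaulay m)
    (dim_R : krull_dim R d) (d_ge1 : (1 <= d)%N)
    (residue_infinite : infinite_set (residue_field m))
    (I_primary : primary_for m I)
    (k_ge2 : (2 <= k)%N) (I_sub : I `<=` ideal_exp m k)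
    (e_hilbert : hilbert_coefficients d I e) :
  e 1%N <= binom2 (e 0%N - k%:Z).
Proof.
have im := max_ideal R_local.
have [t t_diff] := residue_seq im residue_infinite.
have [d' dim' [[s [sz sm reg]] _]] := R_CM.
have ed : d' = d := is_max_uniq dim' dim_R; rewrite ed {d' ed dim'} in sz.
have iI : ideal I by case: I_primary => -[].
have I_rad b : m b -> exists n, I (b ^+ n) by rewrite -I_primary.2.
have [c I_gen] := R_noeth I iI.
(* The induction starts at J = 0, written as the ideal generated by the empty initial segment of the
   regular sequence. *)
have iJ := ideal_gen_ideal [set` ([::] : seq R)].
have J0 J : ideal J -> ideal_gen [set` ([::] : seq R)] `<=` J by move=> iJ'; exact: ideal_gen_min.
case: d d_ge1 sz dim_R e_hilbert => // d _ sz _ [N hN].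
apply: (@hilbert_bound R m I t c k e R_noeth R_local t_diff iI I_rad I_gen k_ge2
  I_sub d _ s iJ) => //.
- exact: J0.
- exact: regular_seq_mod.
exists N => n /hN[l /quot_lengthP[fl <-] el].
by rewrite ideal_addC ideal_add_idl //; [exact: J0 (ideal_exp_ideal _ _)|exact: ideal_exp_ideal].
Qed.
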